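(* Let $a<b$ be real numbers, let $n=2m>1$ be an even integer, and let $f:[a,b]\to\mathbb{R}$ be a function such that $f^{(2m-1)}$ is absolutely continuous on $[a,b]$ and $f^{(2m)}\in L^2[a,b]$. For $\theta\in[0,1]$ put $$c_m(\theta)=\frac{1}{(2m)!\,2^{2m}}\sqrt{\frac{[\theta^2(2m)^2(4m+1)-\theta(16m^2-1)+(4m-1)]-(16m^2-1)\left(\frac1{2m+1}-\theta\right)^2}{(4m+1)(4m-1)}}.$$ Then for all $\theta\in[0,1]$, $$\left|I-F_{2m}-\frac{(b-a)^{2m+1}}{(2m)!\,2^{2m}}\left(\frac1{2m+1}-\theta\right)\frac{f^{(2m-1)}(b)-f^{(2m-1)}(a)}{b-a}\right|\le c_m(\theta)\,(b-a)^{2m+\frac12}\sqrt{\sigma(f^{(2m)})}.$$ This inequality is sharp in the sense that the constant $c_m(\theta)$ cannot be replaced by a smaller one; that is, if $C>0$ is such that the inequality holds with $C$ in place of $c_m(\theta)$ for all such functions $f$, then $C\ge c_m(\theta)$.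
   Context: Notation: $I=\int_a^b f(x)\,dx$, and, for an integer $n\ge1$ and the parameter $\theta\in[0,1]$, $$F_n=(b-a)\left[(1-\theta)f\left(\tfrac{a+b}{2}\right)+\theta\,\tfrac{f(a)+f(b)}{2}\right]+\sum_{i=1}^{\lfloor (n-1)/2\rfloor}\frac{[1-\theta(2i+1)](b-a)^{2i+1}}{(2i+1)!\,2^{2i}}\,f^{(2i)}\left(\tfrac{a+b}{2}\right),$$ where $\lfloor\cdot\rfloor$ is the integer part and an empty sum is $0$. For $g\in L^2[a,b]$, $\sigma(g)=\|g\|_2^2-\frac1{b-a}\left(\int_a^b g(x)\,dx\right)^2$, where $\|g\|_2=\left(\int_a^b|g(x)|^2dx\right)^{1/2}$. $f^{(2m)}$ is defined almost everywhere. *)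

(* Defs.v *)
From HB Require Import structures.
From mathcomp Require Import all_boot all_order all_algebra.
From mathcomp Require Import all_classical all_reals all_analysis.

Set Implicit Arguments.
Unset Strict Implicit.
Unset Printing Implicit Defensive.
Import Order.TTheory GRing.Theory Num.Theory.
Import numFieldNormedType.Exports.
Local Open Scope classical_set_scope.
Local Open Scope ring_scope.

(* A function on [a, b] is a total function R -> R whose values outside [a, b]
   are never used.  Derivatives are taken relative to [a, b], hence one-sided
   at a and at b. *)
Section derivatives_on_segment.
Context {R : realType} (a b : R).

Definition derivable_on (g : R -> R) (x : R) : Prop :=
  cvg ((g y - g x) / (y - x) @[y --> within `[a, b] x^']).

(* Equal to the conventional value of lim, a fixed constant, at the points of
   [a, b] where g is not derivable. *)
Definition derive_on (g : R -> R) (x : R) : R :=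
  lim ((g y - g x) / (y - x) @[y --> within `[a, b] x^']).

Definition deriven_on (k : nat) (g : R -> R) : R -> R := iter k derive_on g.

Definition abs_continuous_on (g : R -> R) : Prop :=
  forall e : R, 0 < e -> exists2 d : R, 0 < d &
    forall (N : nat) (u v : 'I_N -> R),
      (forall i, [/\ a <= u i, u i < v i & v i <= b]) ->
      trivIset setT (fun i => `]u i, v i[%classic) ->
      \sum_(i < N) (v i - u i) < d ->
      \sum_(i < N) `|g (v i) - g (u i)| < e.

Definition L2_on (g : R -> R) : Prop :=
  g \_ `[a, b] \in Lfun (@lebesgue_measure R) 2%:E.

Definition L2norm_on (g : R -> R) : R :=
  fine ('N[@lebesgue_measure R]_2%:E [EFin \o (g \_ `[a, b])])%E.

Definition integral_on (g : R -> R) : R :=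
  \int[@lebesgue_measure R]_(x in `[a, b]) g x.

Definition sigma_on (g : R -> R) : R :=
  L2norm_on g ^+ 2 - (b - a)^-1 * integral_on g ^+ 2.

(* f^(n-1) exists everywhere on [a, b] and is absolutely continuous, so that
   f^(n) exists almost everywhere, and f^(n) is square integrable. *)
Definition admissible (n : nat) (f : R -> R) : Prop :=
  [/\ forall k, (k < n.-1)%N ->
        forall x, x \in `[a, b] -> derivable_on (deriven_on k f) x,
      abs_continuous_on (deriven_on n.-1 f)
    & L2_on (deriven_on n f)].

Definition quadrature (n : nat) (theta : R) (f : R -> R) : R :=
  let mid := (a + b) / 2 in
  (b - a) * ((1 - theta) * f mid + theta * ((f a + f b) / 2)) +
  \sum_(1 <= i < ((n - 1) %/ 2).+1)
     ((1 - theta * (2 * i + 1)%:R) * (b - a) ^+ (2 * i + 1)) /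
     ((2 * i + 1)`!%:R * 2 ^+ (2 * i)) * deriven_on (2 * i) f mid.

Definition error_bound (m : nat) (theta C : R) (f : R -> R) : Prop :=
  `| integral_on f - quadrature (2 * m) theta f -
     (b - a) ^+ (2 * m + 1) / ((2 * m)`!%:R * 2 ^+ (2 * m)) *
     ((2 * m + 1)%:R^-1 - theta) *
     ((deriven_on (2 * m - 1) f b - deriven_on (2 * m - 1) f a) / (b - a)) |
  <= C * (b - a) `^ (2 * m%:R + 2^-1) *
     Num.sqrt (sigma_on (deriven_on (2 * m) f)).

End derivatives_on_segment.

Definition sharp_constant {R : realType} (m : nat) (theta : R) : R :=
  ((2 * m)`!%:R * 2 ^+ (2 * m))^-1 *
  Num.sqrt
    (((theta ^+ 2 * (2 * m%:R) ^+ 2 * (4 * m%:R + 1)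
       - theta * (16 * m%:R ^+ 2 - 1) + (4 * m%:R - 1))
      - (16 * m%:R ^+ 2 - 1) * ((2 * m%:R + 1)^-1 - theta) ^+ 2) /
     ((4 * m%:R + 1) * (4 * m%:R - 1))).

(* Main.v *)
Require Import Defs.
From HB Require Import structures.
From mathcomp Require Import all_boot all_order all_algebra.
From mathcomp Require Import zify ring lra.
From mathcomp Require Import all_classical all_reals all_analysis measurable_realfun.
Import Order.TTheory GRing.Theory Num.Theory.
Import numFieldNormedType.Exports.
Local Open Scope classical_set_scope.
Local Open Scope ring_scope.

Set Implicit Arguments.
Unset Strict Implicit.
Unset Printing Implicit Defensive.

(** Write [n = 2m], [h = (b - a)/2] and let [S] be the Peano kernel, equal to
    [(x-a)^n/n! - theta h (x-a)^(n-1)/(n-1)!] left of the midpoint and to its mirror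
    image on the right. Integrating by parts [n] times on each half gives
    [int S f^(n) = I - F_n]; since [int f^(n) = f^(n-1)(b) - f^(n-1)(a)], the quantity to
    bound is the covariance of [S] and [f^(n)], and Cauchy-Schwarz bounds it by
    [sqrt (sigma S) * sqrt (sigma f^(n))], where
    [sigma S = (sharp_constant * (b-a)^(n+1/2))^2]. As [n] is even, [S] is continuous, so an
    [n]-fold antiderivative of [S] is admissible and turns the bound into an equality.

    The first integration by parts needs the fundamental theorem of calculus for an
    absolutely continuous [g]. Its total variation is again absolutely continuous, so [g]
    is a difference of nondecreasing absolutely continuous functions; the Stieltjes measure
    of such a function is dominated by Lebesgue measure, and the Radon-Nikodym and Lebesgue
    differentiation theorems apply. *)

(** * Absolute continuity and total variation *)

Section abs_continuity.
Context {R : realType}.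
Implicit Types (a b : R) (g : R -> R).

(** Later families are indexed by dependent pairs (interval, subdivision step) or by the dyadic
    cells satisfying a predicate; [enum_val] turns them into families over ordinals. *)
Lemma abs_continuous_on_fin a b g : abs_continuous_on a b g ->
  forall e : R, 0 < e -> exists2 d : R, 0 < d &
    forall (I : finType) (P : pred I) (u v : I -> R),
      (forall i, P i -> [/\ a <= u i, u i < v i & v i <= b]) ->
      trivIset [set` P] (fun i => `]u i, v i[%classic) ->
      \sum_(i | P i) (v i - u i) < d ->
      \sum_(i | P i) `|g (v i) - g (u i)| < e.
Proof.
move=> ac e e0; have [d d0 H] := ac e e0; exists d => // I P u v uv tr.
rewrite (@big_enum_val _ _ _ I P (fun i => v i - u i)).
rewrite (@big_enum_val _ _ _ I P (fun i => `|g (v i) - g (u i)|)).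
apply: H => [i|i j _ _ ij].
  by apply: uv; exact: enum_valP.
by apply: enum_val_inj; apply: tr ij; exact: enum_valP.
Qed.

(** The pieces of all the subdivisions form one disjoint family with the same total length, so the
    same [d] serves. *)
Lemma abs_continuous_on_variation a b g : abs_continuous_on a b g ->
  forall e : R, 0 < e -> exists2 d : R, 0 < d &
    forall (I : finType) (P : pred I) (u v : I -> R) (s : I -> seq R),
      (forall i, P i -> [/\ a <= u i, u i < v i & v i <= b]) ->
      trivIset [set` P] (fun i => `]u i, v i[%classic) ->
      (forall i, P i -> itv_partition (u i) (v i) (s i)) ->
      \sum_(i | P i) (v i - u i) < d ->
      \sum_(i | P i) variation (u i) (v i) g (s i) < e.
Proof.
move=> /abs_continuous_on_fin ac e e0; have [d d0 H] := ac e e0.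
exists d => // I P u v s uv tr sP.
(* Nodes of the [i]-th subdivision, from [x i 0 = u i] to [x i (size (s i)) = v i]; the default
   [v i] is the one used in [variation]. *)
pose x i k := nth (v i) (u i :: s i) k.
have varE f : \sum_(i | P i) \sum_(0 <= k < size (s i)) f (x i k.+1) (x i k) =
    \sum_(p : {i : I & 'I_(size (s i))} | P (tag p))
      f (x (tag p) (tagged p).+1) (x (tag p) (tagged p)) :> R.
  under eq_bigr do rewrite big_mkord.
  rewrite (sig_big_dep P (fun=> xpredT)
    (fun i (k : 'I_(size (s i))) => f (x i k.+1) (x i k))) /=.
  by apply: eq_bigl => p; rewrite andbT.
have -> : \sum_(i | P i) (v i - u i) =
    \sum_(i | P i) \sum_(0 <= k < size (s i)) (x i k.+1 - x i k).
  apply: eq_bigr => i Pi; rewrite telescope_sumr// /x /=.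
  by rewrite (itv_partition_nth_size _ (sP i Pi)).
rewrite /variation (varE (fun p q => p - q)) (varE (fun p q => `|g p - g q|)).
have xmono i k l : P i -> (k <= l)%N -> (l <= size (s i))%N -> x i k <= x i l.
  move=> Pi kl ls.
  elim: l kl ls => [|l IH]; first by rewrite leqn0 => /eqP ->.
  rewrite leq_eqVlt => /orP[/eqP -> //|kl ls].
  apply: le_trans (IH kl (ltnW ls)) _.
  have [/(pathP (v i))/(_ l ls) h _] := sP i Pi.
  exact: ltW.
have xin i k : P i -> (k <= size (s i))%N -> u i <= x i k <= v i.
  move=> Pi ks; rewrite (xmono i 0 k Pi isT ks)/=.
  by rewrite -(itv_partition_nth_size (v i) (sP i Pi)) xmono.
apply: H => [[i k] /= Pi|[i k] [j l] /= Pi Pj].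
  have [au uvi vb] := uv i Pi.
  have /andP[h1 _] := xin i k Pi (ltnW (ltn_ord k)).
  have /andP[_ h2] := xin i k.+1 Pi (ltn_ord k).
  split; [exact: le_trans au h1| |exact: le_trans h2 vb].
  by have [/(pathP (v i))/(_ k (ltn_ord k))] := sP i Pi.
(* A common point [y] of two pieces lies in both enclosing intervals, which therefore coincide;
   monotonicity of the nodes then forces equal ranks. *)
move=> -[y [/=]]; rewrite !in_itv/= => /andP[k1 k2] /andP[l1 l2].
have ij : i = j.
  apply: tr => //; exists y; split; rewrite /= in_itv/=.
    have /andP[h1 _] := xin i k Pi (ltnW (ltn_ord k)).
    have /andP[_ h2] := xin i k.+1 Pi (ltn_ord k).
    by rewrite (le_lt_trans h1 k1) (lt_le_trans k2 h2).
  have /andP[h1 _] := xin j l Pj (ltnW (ltn_ord l)).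
  have /andP[_ h2] := xin j l.+1 Pj (ltn_ord l).
  by rewrite (le_lt_trans h1 l1) (lt_le_trans l2 h2).
subst j; congr existT; apply: val_inj => /=.
have [kl|lk|//] := ltngtP k l; exfalso.
  have := xmono i k.+1 l Pi kl (ltnW (ltn_ord l)).
  by rewrite leNgt (lt_trans l1 k2).
have := xmono i l.+1 k Pi lk (ltnW (ltn_ord k)).
by rewrite leNgt (lt_trans k1 l2).
Qed.

(** The [d] attached to [e = 1] bounds by 1 the variation over any interval shorter than [d], and
    finitely many steps of length [d / 2] cover [[a, b]]. *)
Lemma abs_continuous_on_bounded_variation a b g : a <= b ->
  abs_continuous_on a b g -> bounded_variation a b g.
Proof.
move=> ab ac; have [d d0 H] := abs_continuous_on_variation ac ltr01.
have short c e : a <= c -> c < e -> e <= b -> e - c < d ->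
    bounded_variation c e g.
  move=> ac' ce eb ced; exists 1 => _ [s cs <-].
  have := H unit xpredT (fun=> c) (fun=> e) (fun=> s).
  rewrite !big_const !card_unit/= !addr0 => /(_ _ _ _ _)/ltW; apply => //.
  by move=> [] [].
pose N := Num.bound ((b - a) / (d / 2)).
have d20 : 0 < d / 2 by rewrite divr_gt0.
have bN : b <= a + (d / 2) *+ N.
  rewrite -lerBlDl -mulr_natl -ler_pdivrMr//.
  by apply/ltW/archi_boundP; rewrite divr_ge0 ?subr_ge0// ltW.
pose x k := Num.min b (a + (d / 2) *+ k).
have ax k : a <= x k by rewrite le_min ab lerDl mulrn_wge0// ltW.
have xb k : x k <= b by rewrite ge_min lexx.
suff : bounded_variation a (x N) g by rewrite /x min_l.
elim: N {bN} => [|k IH].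
  rewrite /x mulr0n addr0 min_r//; exact (bounded_variationxx a g).
have xk : x k <= x k.+1.
  rewrite le_min xb ge_min /=; apply/orP; right.
  by rewrite lerD2l ler_pMn2l.
have [<-//|xkN] := eqVneq (x k) (x k.+1).
have xlt : x k < x k.+1 by rewrite lt_neqAle xkN.
apply/bounded_variationP => //.
rewrite (total_variationD g (ax k) xk) fin_numD; apply/andP; split.
  exact/bounded_variationP.
apply/bounded_variationP => //; apply: short => //.
(* Since [x k < x k.+1], the cap at [b] is not yet active at [k]. *)
have xkE : x k = a + (d / 2) *+ k.
  rewrite /x min_r// leNgt; apply/negP => h; move: xlt.
  by rewrite {1}/x min_l ?ltW// ltNge xb.
rewrite ltrBlDl xkE (@le_lt_trans _ _ (a + d / 2 *+ k.+1))//.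
  by rewrite /x ge_min lexx orbT.
by rewrite mulrSr addrA ltrD2l gtr_pMr ?invf_lt1 ?ltr1n.
Qed.

End abs_continuity.

Section total_variation_abs_continuity.
Context {R : realType}.
Implicit Types (a b : R) (g : R -> R).
Local Notation TV := total_variation.

Lemma bounded_variationS a b c d g : a <= c -> c <= d -> d <= b ->
  bounded_variation a b g -> bounded_variation c d g.
Proof.
move=> ac cd db; move/(bounded_variationP g (le_trans ac (le_trans cd db))).
rewrite (total_variationD g ac (le_trans cd db)) (total_variationD g cd db).
rewrite !fin_numD => /and3P[_ h _]; exact/bounded_variationP.
Qed.

Lemma fine_total_variationB a b g x y : bounded_variation a b g ->
  a <= x -> x <= y -> y <= b ->
  fine (TV a y g) - fine (TV a x g) = fine (TV x y g).
Proof.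
move=> bv ax xy yb; rewrite (total_variationD g ax xy).
rewrite fineD; first by rewrite [_ + fine _]addrC addrK.
  apply/bounded_variationP => //.
  exact: bounded_variationS (lexx a) ax (le_trans xy yb) bv.
by apply/bounded_variationP => //; exact: bounded_variationS ax xy yb bv.
Qed.

(** On each interval a subdivision nearly attains the total variation. The variations along these
    subdivisions add up to less than [e / 2], and so do the defects. *)
Lemma abs_continuous_on_total_variation a b g : a <= b ->
  abs_continuous_on a b g ->
  abs_continuous_on a b (fun x => fine (TV a x g)).
Proof.
move=> ab ac e e0.
have bv := abs_continuous_on_bounded_variation ab ac.
have [d d0 H] := abs_continuous_on_variation ac (divr_gt0 e0 (ltr0n R 2)).
exists d => // N u v uv tr uvd.
have tE i : `|fine (TV a (v i) g) - fine (TV a (u i) g)| = fine (TV (u i) (v i) g).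
  have [au uvi vb] := uv i; have uvi' := ltW uvi.
  rewrite (fine_total_variationB bv)// ger0_norm//.
  by rewrite fine_ge0// total_variation_ge0.
under eq_bigr do rewrite tE.
(* Dividing by [N.+1] covers [N = 0] and keeps the sum of the [N] defects strictly below [e / 2]. *)
pose eta := e / 2 / N.+1%:R.
have eta0 : 0 < eta by rewrite !divr_gt0.
have sP i : {s | itv_partition (u i) (v i) s &
    fine (TV (u i) (v i) g) <= variation (u i) (v i) g s + eta}.
  apply: cid2; have [au uvi vb] := uv i; have uvi' := ltW uvi.
  have fT : TV (u i) (v i) g \is a fin_num.
    by apply/bounded_variationP => //; exact: bounded_variationS bv.
  have [_ [_ [s sp <-] <-]] := ub_ereal_sup_adherent eta0 fT.
  rewrite -/(TV (u i) (v i) g) -(fineK fT) -EFinB lte_fin ltrBlDr => /ltW h.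
  by exists s.
pose s i := s2val (sP i).
have hs i : itv_partition (u i) (v i) (s i) by exact: (s2valP (sP i)).
have := H _ xpredT u v s (fun i _ => uv i) _ (fun i _ => hs i) uvd.
have -> : [set` xpredT] = [set: 'I_N] by apply/seteqP; split.
move=> /(_ tr) h.
apply: (@le_lt_trans _ _ (\sum_(i < N) (variation (u i) (v i) g (s i) + eta))).
  by apply: ler_sum => i _; exact: (s2valP' (sP i)).
rewrite big_split /= [ltRHS]splitr ltrD//.
rewrite sumr_const card_ord.
have -> : eta *+ N = (e / 2) * (N%:R / N.+1%:R) by rewrite -mulr_natl mulrCA.
by rewrite gtr_pMr ?divr_gt0// ltr_pdivrMr// mul1r ltr_nat.
Qed.

Lemma abs_continuous_onB a b f g : abs_continuous_on a b f ->
  abs_continuous_on a b g -> abs_continuous_on a b (fun x => f x - g x).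
Proof.
move=> acf acg e e0; have e20 : 0 < e / 2 by rewrite divr_gt0.
have [d d0 Hf] := acf _ e20; have [d' d'0 Hg] := acg _ e20.
exists (Num.min d d') => [|N u v uv tr]; first by rewrite lt_min d0.
rewrite lt_min => /andP[ud ud'].
apply: le_lt_trans (ler_sum _ _) _ => [i _|].
  have -> : f (v i) - g (v i) - (f (u i) - g (u i)) =
    (f (v i) - f (u i)) - (g (v i) - g (u i)) by ring.
  exact: ler_normB.
by rewrite big_split/= [ltRHS]splitr ltrD ?Hf ?Hg.
Qed.

End total_variation_abs_continuity.

(** * Densities of absolutely continuous functions *)

Section dyadic_cells.
Context {R : realType}.
Variables (a b : R).
Hypothesis ab : a < b.
Implicit Types (k i : nat) (U : set R).

(** Open on the left and closed on the right: the cells of one level tile []a, b]], and the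
    Stieltjes measure of such an interval is an increment of its function. *)
Definition dyadic_cell k i : set R :=
  `]a + (b - a) / 2 ^+ k * i%:R, a + (b - a) / 2 ^+ k * i.+1%:R]%classic.

(* The cells of level [k] contained in an open set [U] are disjoint and increase to
   [U `&` `]a, b]], so absolute continuity controls the Stieltjes measure of [U]. *)
Definition dyadic_inner U k : set R :=
  \big[setU/set0]_(i < 2 ^ k | `[< dyadic_cell k i `<=` U >]) dyadic_cell k i.

Lemma dyadic_step_gt0 k : 0 < (b - a) / 2 ^+ k.
Proof. by rewrite divr_gt0 ?subr_gt0 ?exprn_gt0. Qed.

Lemma dyadic_node_le k i : (i <= 2 ^ k)%N -> a + (b - a) / 2 ^+ k * i%:R <= b.
Proof.
move=> ik; rewrite -lerBrDl -mulrA ger_pMr ?subr_gt0// mulrC ler_pdivrMr ?exprn_gt0//.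
by rewrite mul1r -natrX ler_nat.
Qed.

Lemma dyadic_node_ge k i : a <= a + (b - a) / 2 ^+ k * i%:R.
Proof. by rewrite lerDl mulr_ge0// ltW// dyadic_step_gt0. Qed.

Lemma dyadic_node_lt k i :
  a + (b - a) / 2 ^+ k * i%:R < a + (b - a) / 2 ^+ k * i.+1%:R.
Proof. by rewrite ltrD2l ltr_pM2l ?dyadic_step_gt0// ltr_nat. Qed.

Lemma trivIset_dyadic_cell k : trivIset setT (dyadic_cell k).
Proof.
move=> i j _ _ [x [/=]]; rewrite /dyadic_cell/= !in_itv/= => /andP[i1 i2] /andP[j1 j2].
have h p q : a + (b - a) / 2 ^+ k * p%:R < x ->
    x <= a + (b - a) / 2 ^+ k * q.+1%:R -> (p <= q)%N.
  move=> px xq; have := lt_le_trans px xq.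
  by rewrite ltrD2l ltr_pM2l ?dyadic_step_gt0// ltr_nat.
by apply/eqP; rewrite eqn_leq (h i j) ?(h j i).
Qed.

Lemma dyadic_cell_ex k x : a < x -> x <= b ->
  exists2 i, (i < 2 ^ k)%N & dyadic_cell k i x.
Proof.
move=> ax xb; have s0 := dyadic_step_gt0 k.
pose t := (x - a) / ((b - a) / 2 ^+ k).
have t0 : 0 < t by rewrite divr_gt0 ?subr_gt0.
have xE : x = a + (b - a) / 2 ^+ k * t by rewrite /t mulrC divfK ?gt_eqF// addrC subrK.
(* Cells being closed on the right, the index sought is the ceiling of [t] minus one. *)
have := ceil_itv t; have : 0 < Num.ceil t by rewrite ceil_gt0.
case: (Num.ceil t) => [[//|n]|//] _ /andP[h1 h2].
have nt : n%:R < t by move: h1; rewrite -[n.+1]addn1 PoszD addrK -pmulrn.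
exists n.
  have : t <= 2 ^+ k.
    rewrite /t ler_pdivrMr// mulrC divfK ?expf_neq0//.
    by rewrite lerD2r.
  by move=> /(lt_le_trans nt); rewrite -natrX ltr_nat.
by rewrite /dyadic_cell /= in_itv/= {1 2}xE lerD2l ltrD2l ltr_pM2l// ler_pM2l// nt.
Qed.

Lemma dyadic_innerP U k x : dyadic_inner U k x <->
  exists i, [/\ (i < 2 ^ k)%N, dyadic_cell k i `<=` U & dyadic_cell k i x].
Proof.
rewrite /dyadic_inner -(big_mkord (fun i => `[< dyadic_cell k i `<=` U >])).
rewrite -bigcup_seq_cond; split=> [[i /= /andP[]]|[i [ik iU ix]]].
  by rewrite mem_index_iota => /andP[_ ik] /asboolP iU xi; exists i.
by exists i => //=; rewrite mem_index_iota ik; apply/asboolP.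
Qed.

Lemma dyadic_inner_homo U : {homo dyadic_inner U : n m / (n <= m)%N >-> (n <= m)%O}.
Proof.
apply/nondecreasing_seqP => k; apply/subsetPset => x.
move=> /dyadic_innerP[i [ik iU xi]]; apply/dyadic_innerP.
have sE : (b - a) / 2 ^+ k = 2 * ((b - a) / 2 ^+ k.+1).
  by rewrite exprS invfM; field; rewrite expf_neq0.
have s0 := dyadic_step_gt0 k.+1.
(* Cell [i] splits into the cells [2 * i] and [2 * i + 1] of the next level; the half containing [x]
   still lies in [U]. *)
have : exists2 j, (j < 2 ^ k.+1)%N & dyadic_cell k.+1 j x /\
    dyadic_cell k.+1 j `<=` dyadic_cell k i.
  move: xi; rewrite /dyadic_cell/= in_itv/= sE; move: s0; set s := (_ / _) => s0.
  move=> /andP[x1 x2].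
  have e0 : (2 * i)%:R = 2 * i%:R :> R by rewrite natrM.
  have e1 : (2 * i).+1%:R = 2 * i%:R + 1 :> R by rewrite -natr1 natrM.
  have e1' : (2 * i + 1)%:R = 2 * i%:R + 1 :> R by rewrite natrD natrM.
  have e2 : (2 * i + 1).+1%:R = 2 * i%:R + 2 :> R.
    by rewrite -natr1 natrD natrM -addrA.
  have e3 : i.+1%:R = i%:R + 1 :> R by rewrite natr1.
  have [xm|mx] := leP x (a + s * (2 * i%:R + 1)).
    exists (2 * i)%N; first by rewrite expnS ltn_pmul2l.
    split.
      rewrite /= in_itv/= e1 xm andbT.
      by apply: le_lt_trans x1; rewrite e0; lra.
    by apply: subset_itv; rewrite bnd_simp ?e0 ?e1 ?e3; lra.
  exists (2 * i + 1)%N; first by rewrite expnS; move: ik; lia.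
  split; first by rewrite /= in_itv/= e1' mx (le_trans x2)// e2 e3; lra.
  by apply: subset_itv; rewrite bnd_simp ?e2 ?e1' ?e3; lra.
by move=> [j jk [xj ji]]; exists j; split => //; exact: subset_trans iU.
Qed.

Lemma dyadic_inner_sub U k : dyadic_inner U k `<=` U `&` `]a, b].
Proof.
move=> x /dyadic_innerP[i [ik iU xi]]; split; first exact: iU.
move: xi; rewrite /dyadic_cell/= !in_itv/= => /andP[x1 x2].
by rewrite (le_lt_trans (dyadic_node_ge k i) x1) (le_trans x2 (dyadic_node_le ik)).
Qed.

Lemma bigcup_dyadic_inner U : open U ->
  \bigcup_k dyadic_inner U k = U `&` `]a, b].
Proof.
move=> oU; apply/seteqP; split.
  by apply: bigcup_sub => k _; exact: dyadic_inner_sub.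
move=> x [Ux]; rewrite /= in_itv/= => /andP[ax xb].
have /nbhs_ballP[e /= e0 eU] : nbhs x U by exact: open_nbhs_nbhs.
(* As [k < 2 ^ k], cells of this level are shorter than [e], so the one containing [x] stays in the
   ball and hence in [U]. *)
pose k := Num.bound ((b - a) / e).
have bae : 0 <= (b - a) / e by rewrite divr_ge0 ?subr_ge0 ?ltW.
have ske : (b - a) / 2 ^+ k < e.
  rewrite ltr_pdivrMr ?exprn_gt0// mulrC -ltr_pdivrMr//.
  apply: lt_trans (archi_boundP bae) _.
  by rewrite -natrX ltr_nat ltn_expl.
have [i ik xi] := dyadic_cell_ex k ax xb.
exists k => //; apply/dyadic_innerP; exists i; split => // y yi; apply: eU; rewrite /ball/=.
apply: le_lt_trans ske; move: xi yi; rewrite /dyadic_cell/= !in_itv/= -[i.+1%:R]natr1.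
rewrite mulrDr mulr1 addrA; set p := a + _; set s := _ / _.
by move=> /andP[x1 x2] /andP[y1 y2]; rewrite ler_distlC; apply/andP; split; lra.
Qed.

Lemma measurable_dyadic_cell k i :
  measurable (dyadic_cell k i : set (measurableTypeR R)).
Proof. exact: measurable_itv. Qed.

Lemma measurable_dyadic_inner U k :
  measurable (dyadic_inner U k : set (measurableTypeR R)).
Proof. by apply: bigsetU_measurable => i _; exact: measurable_dyadic_cell. Qed.

Lemma content_dyadic_inner (mu : {content set (measurableTypeR R) -> \bar R}) U k :
  mu (dyadic_inner U k) =
  (\sum_(i < 2 ^ k | `[< dyadic_cell k i `<=` U >]) mu (dyadic_cell k i))%E.
Proof.
rewrite /dyadic_inner measure_bigsetU_ord// => [i|].
  exact: measurable_dyadic_cell.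
move=> i j _ _ /trivIset_dyadic_cell ij; apply: val_inj; exact: ij.
Qed.

End dyadic_cells.

Lemma lebesgue_stieltjes_measure_itvoc (R : realType) (f : cumulative R R) (u v : R) :
  u <= v -> lebesgue_stieltjes_measure f `]u, v]%classic = (f v - f u)%:E.
Proof.
move=> uv; rewrite /lebesgue_stieltjes_measure/= /measure_extension/=.
by rewrite measurable_mu_extE/= ?wlength_itv_bnd//; exact: is_ocitv.
Qed.

Section nondecreasing_density.
Context {R : realType}.
Variables (a b : R) (G : R -> R).
Hypotheses (ab : a < b) (acG : abs_continuous_on a b G).
Hypothesis ndG : {in `[a, b] &, {homo G : x y / x <= y}}.
Local Notation mu := (@lebesgue_measure R).

(* [G] made constant outside [[a, b]], so that it is a cumulative function on [R]. *)
Definition clamp_fun (x : R) : R := G (Num.max a (Num.min x b)).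

Let clamp_in x : Num.max a (Num.min x b) \in `[a, b].
Proof. by rewrite in_itv/= le_max lexx/= ge_max ltW//= ge_min lexx orbT. Qed.

Let clampE x : x \in `[a, b] -> clamp_fun x = G x.
Proof.
by rewrite in_itv/= /clamp_fun => /andP[ax xb]; rewrite (min_idPl xb) (max_idPr ax).
Qed.

Let clamp_le x y : x <= y ->
  Num.max a (Num.min x b) <= Num.max a (Num.min y b).
Proof.
move=> xy; rewrite ge_max; apply/andP; split; first by rewrite le_max lexx.
rewrite le_max; apply/orP; right; rewrite le_min; apply/andP; split.
  by rewrite ge_min xy.
by rewrite ge_min lexx orbT.
Qed.

Let clamp_nd : {homo clamp_fun : x y / x <= y}.
Proof.
by move=> x y xy; apply: ndG => //; exact: clamp_le.
Qed.

Let clamp_rc : right_continuous clamp_fun.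
Proof.
apply: right_continuousW => x; apply/(@cvgrPdist_lt _ R^o) => e e0.
have [d d0 H] := acG e0; near=> y.
have xyd : `|x - y| < d by near: y; exact: (@cvgr_dist_lt _ R^o).
(* Absolute continuity for a single interval; clamping both ends does not increase their
   distance. *)
have cont (u v : R) : u <= v -> v - u < d -> clamp_fun v - clamp_fun u < e.
  move=> uv uvd.
  set p := Num.max a (Num.min u b); set q := Num.max a (Num.min v b).
  have pq : p <= q by exact: clamp_le.
  have [pq'|qp] := ltP p q; last first.
    have -> : clamp_fun v = clamp_fun u; last by rewrite subrr.
    by rewrite /clamp_fun -/p -/q; congr G; apply/eqP; rewrite eq_le pq qp.
  have := H 1%N (fun=> p) (fun=> q); rewrite !big_ord1.
  move=> /(_ _ _ _)/(le_lt_trans (ler_norm _)); apply.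
  - by move=> _; move: (clamp_in u) (clamp_in v); rewrite !in_itv/= => /andP[? _] /andP[_ ?].
  - by move=> i j _ _ _; rewrite !ord1.
  apply: le_lt_trans uvd; rewrite /p /q.
  have : Num.min v b - Num.min u b <= v - u.
    by case: (leP u b); case: (leP v b) => *; lra.
  by case: (leP a (Num.min u b)); case: (leP a (Num.min v b)) => *; lra.
have [yx|xy] := leP y x.
  by rewrite ger0_norm ?subr_ge0 ?clamp_nd// cont// (le_lt_trans (ler_norm _)).
rewrite distrC ger0_norm ?subr_ge0 ?clamp_nd ?ltW// cont ?ltW//.
by rewrite (le_lt_trans (ler_norm _))// distrC.
Unshelve. all: by end_near. Qed.

HB.instance Definition _ := isCumulative.Build R _ R clamp_fun clamp_nd clamp_rc.

Let nu : {measure set (measurableTypeR R) -> \bar R} :=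
  lebesgue_stieltjes_measure clamp_fun.

Let nuE u v : a <= u -> u <= v -> v <= b -> nu `]u, v]%classic = (G v - G u)%:E.
Proof.
move=> au uv vb; rewrite [LHS]lebesgue_stieltjes_measure_itvoc//= !clampE//
  in_itv/= ?au ?vb ?andbT//.
  exact: le_trans uv vb.
exact: le_trans au uv.
Qed.

Let muE (u v : R) : u <= v -> mu `]u, v]%classic = (v - u)%:E.
Proof.
by move=> uv; rewrite lebesgue_measure_itv/= lte_fin; case: ltgtP uv => // ->; rewrite subrr.
Qed.

Let mD : measurable (`]a, b] : set (measurableTypeR R)).
Proof. exact: measurable_itv. Qed.

Let nuD : (nu `]a, b]%classic < +oo)%E.
Proof. by rewrite nuE ?(ltW ab)// ltry. Qed.

(** The restriction to []a, b]] is a finite measure, to which Radon-Nikodym applies. *)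
Let nu_ab := mfrestr mD nuD.

(** Each [dyadic_inner] set is a finite disjoint union of cells of total length below [d], so its
    [nu]-measure is below [e]; continuity from below passes to [U], with a weak inequality. *)
Let nu_open (e : R) : 0 < e -> exists2 d : R, 0 < d &
  forall U : set R, open U -> (mu (U `&` `]a, b]%classic) < d%:E)%E ->
  (nu (U `&` `]a, b]%classic) <= e%:E)%E.
Proof.
move=> e0; have [d d0 H] := abs_continuous_on_fin acG e0; exists d => // U oU muU.
have mk k := measurable_dyadic_inner a b U k.
have mU : measurable (\bigcup_k dyadic_inner a b U k : set (measurableTypeR R)).
  exact: bigcup_measurable.
have cv := nondecreasing_cvg_mu (mu := nu) mk mU (@dyadic_inner_homo _ _ _ ab U).
rewrite -(bigcup_dyadic_inner ab oU) -(cvg_lim _ cv)//.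
apply: lime_le; first by apply/cvg_ex; eexists; exact: cv.
apply: nearW => k /=.
have : (mu (dyadic_inner a b U k) < d%:E)%E.
  apply: le_lt_trans muU; rewrite le_measure ?inE//.
    apply: measurableI; last exact: measurable_itv.
    exact: measurable_realfun.open_measurable.
  exact: dyadic_inner_sub.
rewrite !(content_dyadic_inner ab).
pose x i := a + (b - a) / 2 ^+ k * i%:R.
have muc i : mu (dyadic_cell a b k i) = (x i.+1 - x i)%:E.
  by rewrite /dyadic_cell muE// ltW// dyadic_node_lt.
have nuc (i : 'I_(2 ^ k)) : nu (dyadic_cell a b k i) = (G (x i.+1) - G (x i))%:E.
  rewrite /dyadic_cell nuE//; first exact: dyadic_node_ge.
    by rewrite ltW// dyadic_node_lt.
  exact: dyadic_node_le.
rewrite (eq_bigr (fun i : 'I__ => (x i.+1 - x i)%:E)); last by move=> i _; exact: muc.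
rewrite [in X in _ -> X](eq_bigr (fun i : 'I__ => (G (x i.+1) - G (x i))%:E)); last first.
  by move=> i _; exact: nuc.
rewrite !sumEFin lte_fin lee_fin => h.
apply: (le_trans _ (ltW (H _ _ (fun i : 'I_(2 ^ k) => x i) (fun i : 'I_(2 ^ k) => x i.+1) _ _ h))).
- by apply: ler_sum => i _; exact: ler_norm.
- move=> i _; split; [exact: dyadic_node_ge|exact: dyadic_node_lt|exact: dyadic_node_le].
move=> i j _ _ [y [/=]]; rewrite !in_itv/= => /andP[i1 i2] /andP[j1 j2].
apply: val_inj; apply: (@trivIset_dyadic_cell _ a b ab k) => //; exists y.
by rewrite /dyadic_cell /= !in_itv/= i1 j1 !ltW.
Qed.

(** By outer regularity a null set lies in an open set of measure below [d], so [nu_open] bounds its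
    [nu_ab]-measure by every [e > 0]. *)
Let nu_ab_dom : nu_ab `<< mu.
Proof.
apply/null_content_dominatesP => A mA muA; apply/eqP; rewrite eq_le measure_ge0 andbT.
apply/lee_addgt0Pr => e e0; rewrite add0e.
have [d d0 H] := nu_open e0.
have muAoo : (mu A < +oo)%E by rewrite muA.
have [U [oU AU muUA]] := lebesgue_regularity_outer mA muAoo d0.
have mU : measurable (U : set (measurableTypeR R)) by exact: measurable_realfun.open_measurable.
rewrite /nu_ab /mfrestr /mrestr; apply: le_trans (H U oU _).
  by rewrite le_measure ?inE//; [exact: measurableI|exact: measurableI|exact: setSI].
apply: le_lt_trans muUA.
apply: (@le_trans _ _ (mu U)).
  by rewrite le_measure ?inE//; exact: measurableI.
rewrite -{1}(setDUK AU); apply: (le_trans (measureU2 _ _ _)) => //.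
  exact: measurableD.
by rewrite [X in (X + _)%E]muA add0e.
Qed.

(** [h] is the Radon-Nikodym derivative of [nu_ab], evaluated on []a, x]]; adding the point [a] does
    not change the integral. *)
Lemma nondecreasing_abs_continuous_density :
  exists2 h : R -> R, mu.-integrable setT (EFin \o h) &
  forall x, x \in `[a, b] -> G x - G a = \int[mu]_(t in `[a, x]) h t.
Proof.
have [f [f0 ffin fint fE]] := radon_nikodym_sigma_finite nu_ab_dom.
have hf : EFin \o (fine \o f) = f by apply/funext => x /=; rewrite fineK.
exists (fine \o f); first by rewrite hf.
move=> x; rewrite in_itv/= => /andP[ax xb].
have nuabE : nu_ab `]a, x]%classic = (G x - G a)%:E.
  transitivity (nu (`]a, x]%classic `&` `]a, b]%classic)); first by [].
  by rewrite setIidl ?nuE//; apply: subset_itvl; rewrite bnd_simp.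
move: (fE _ (measurable_itv `]a, x])); rewrite [X in X = _ -> _]nuabE => /(congr1 fine) /= ->.
rewrite -Rintegral_itv_obnd_cbnd; last first.
  by rewrite hf; apply: integrableS fint.
by congr fine; apply: eq_integral => t _ /=; rewrite fineK.
Qed.

End nondecreasing_density.

Section abs_continuous_density.
Context {R : realType}.
Variables (a b : R) (g : R -> R).
Hypotheses (ab : a < b) (acg : abs_continuous_on a b g).
Local Notation mu := (@lebesgue_measure R).

(** Jordan decomposition [g = T - (T - g)] with [T] the total variation function; both parts are
    nondecreasing because [|g y - g x| <= T y - T x] for [x <= y]. *)
Lemma abs_continuous_density :
  exists2 h : R -> R, mu.-integrable setT (EFin \o h) &
  forall x, x \in `[a, b] -> g x - g a = \int[mu]_(t in `[a, x]) h t.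
Proof.
have bv := abs_continuous_on_bounded_variation (ltW ab) acg.
pose T x := fine (total_variation a x g).
have acT : abs_continuous_on a b T.
  exact: abs_continuous_on_total_variation (ltW ab) acg.
have TB x y : x \in `[a, b] -> y \in `[a, b] -> x <= y ->
    `|g y - g x| <= T y - T x.
  rewrite !in_itv/= => /andP[ax xb] /andP[ay yb] xy.
  rewrite (fine_total_variationB bv)// -lee_fin fineK ?total_variation_ge//.
  by apply/bounded_variationP => //; exact: bounded_variationS bv.
have [h1 ih1 h1E] : exists2 h : R -> R, mu.-integrable setT (EFin \o h) &
    forall x, x \in `[a, b] -> T x - T a = \int[mu]_(t in `[a, x]) h t.
  apply: nondecreasing_abs_continuous_density => // x y xab yab xy.
  by rewrite -subr_ge0; apply: le_trans (TB _ _ xab yab xy).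
have [h2 ih2 h2E] : exists2 h : R -> R, mu.-integrable setT (EFin \o h) &
    forall x, x \in `[a, b] ->
      (T x - g x) - (T a - g a) = \int[mu]_(t in `[a, x]) h t.
  apply: (@nondecreasing_abs_continuous_density _ a b (fun x => T x - g x)) => //.
    exact: abs_continuous_onB.
  move=> x y xab yab xy /=.
  have := le_trans (ler_norm _) (TB _ _ xab yab xy); lra.
exists (fun x => h1 x - h2 x).
  by have := integrableB measurableT ih1 ih2; apply: eq_integrable => // x _.
move=> x xab; rewrite RintegralB//; last 2 first.
- exact: integrableS ih1.
- exact: integrableS ih2.
by rewrite -h1E// -h2E//; ring.
Qed.

End abs_continuous_density.

(** * Derivatives relative to a segment *)

Section derivatives_relative_to_a_segment.
Context {R : realType}.
Variables (a b : R).
Hypothesis ab : a < b.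
Implicit Types (f g : R -> R) (p : {poly R}).

(** Since [a < b], every point of [[a, b]] is an accumulation point of it, approached from the right
    except at [b]. This makes the limit in [derive_on] unique. *)
Lemma within_segment_dnbhs_proper x : x \in `[a, b] ->
  ProperFilter (within `[a, b] x^').
Proof.
rewrite in_itv/= => /andP[ax xb]; apply: Build_ProperFilter_ex => P.
rewrite /within/= => /nbhs_ballP[e /= e0 eP].
have [xltb|bx] := ltP x b.
  exists (x + Num.min (e / 2) (b - x)).
  have m0 : 0 < Num.min (e / 2) (b - x) by rewrite lt_min subr_gt0 xltb divr_gt0.
  have mb : Num.min (e / 2) (b - x) <= b - x by rewrite ge_min lexx orbT.
  have me : Num.min (e / 2) (b - x) <= e / 2 by rewrite ge_min lexx.
  apply: eP => /=.
  - by rewrite /ball/= opprD addNKr normrN gtr0_norm//; lra.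
  - by rewrite -subr_eq0 addrAC subrr add0r gt_eqF.
  - by rewrite in_itv/=; apply/andP; split; lra.
exists (x - Num.min (e / 2) (x - a)).
have ax' : a < x := lt_le_trans ab bx.
have m0 : 0 < Num.min (e / 2) (x - a) by rewrite lt_min subr_gt0 ax' divr_gt0.
have mb : Num.min (e / 2) (x - a) <= x - a by rewrite ge_min lexx orbT.
have me : Num.min (e / 2) (x - a) <= e / 2 by rewrite ge_min lexx.
apply: eP => /=.
- by rewrite /ball/= opprD opprK addNKr gtr0_norm//; lra.
- by rewrite -subr_eq0 addrAC subrr add0r oppr_eq0 gt_eqF.
- by rewrite in_itv/=; apply/andP; split; lra.
Qed.

Lemma is_derive_quotient_cvg g (x l : R) : is_derive x 1 g l ->
  (g y - g x) / (y - x) @[y --> within `[a, b] x^'] --> l.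
Proof.
move=> /is_derive1_caratheodory[phi [phiE cphi <-]].
apply: cvg_within_filter.
apply: (@cvg_trans _ (phi y @[y --> x^'])); last exact: cvg_within_filter.
apply: near_eq_cvg; near=> y; rewrite phiE mulfK// subr_eq0.
by near: y; exact: nbhs_dnbhs_neq.
Unshelve. all: by end_near. Qed.

Lemma cvg_derive_on g (x l : R) : x \in `[a, b] ->
  (g y - g x) / (y - x) @[y --> within `[a, b] x^'] --> l ->
  derive_on a b g x = l.
Proof.
by move=> xab /cvg_lim; apply => //; exact: within_segment_dnbhs_proper.
Qed.

Lemma is_derive_derive_on g (x l : R) : x \in `[a, b] -> is_derive x 1 g l ->
  derivable_on a b g x /\ derive_on a b g x = l.
Proof.
move=> xab /is_derive_quotient_cvg h; split; last exact: cvg_derive_on.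
by apply/cvg_ex; exists l.
Qed.

(** Near an interior point the restriction to [[a, b]] is void, so the difference quotient completed
    by its limit at [x] is a Caratheodory slope function. *)
Lemma derivable_on_is_derive g (x : R) : x \in `]a, b[ -> derivable_on a b g x ->
  is_derive x 1 g (derive_on a b g x).
Proof.
move=> xab; rewrite /derivable_on -/(derive_on a b g x) => h.
apply/is_derive1_caratheodory.
exists (fun y => if y == x then derive_on a b g x else (g y - g x) / (y - x)).
split; last by rewrite eqxx.
  move=> z; case: eqVneq => [->|zx]; first by rewrite !subrr mulr0.
  by rewrite divfK// subr_eq0.
apply/(@cvgrPdist_lt _ R^o) => e e0; rewrite eqxx.
move/(@cvgrPdist_lt _ R^o)/(_ e e0) : h => H.
have {}H : nbhs x (fun t => t != x -> `[a, b]%classic t ->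
    `|derive_on a b g x - (g t - g x) / (t - x)| < e) := H.
near=> y; case: eqVneq => [_|yx]; first by rewrite subrr normr0.
apply: (near H y) => //.
have : y \in `]a, b[ by near: y; exact: near_in_itvoo.
by rewrite /= !in_itv/= => /andP[/ltW -> /ltW ->].
Unshelve. all: by end_near. Qed.

Lemma abs_continuous_on_continuous g : abs_continuous_on a b g ->
  {within `[a, b], continuous g}.
Proof.
move=> acg; apply/subspace_continuousP => x; rewrite /= in_itv/= => /andP[ax xb].
apply/(@cvgrPdist_lt _ R^o) => e e0; have [d d0 H] := acg e e0.
rewrite near_withinE; near=> y; rewrite /= in_itv/= => /andP[ay yb].
have xyd : `|x - y| < d by near: y; exact: (@cvgr_dist_lt _ R^o).
have cont (u v : R) : a <= u -> u < v -> v <= b -> `|v - u| < d -> `|g v - g u| < e.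
  move=> au uv vb; rewrite gtr0_norm ?subr_gt0// => uvd.
  have := H 1%N (fun=> u) (fun=> v); rewrite !big_ord1.
  by apply=> // i j _ _ _; rewrite !ord1.
have [xy|yx|->] := ltgtP x y.
- by rewrite distrC cont// distrC.
- by rewrite cont.
- by rewrite subrr normr0.
Unshelve. all: by end_near. Qed.

Lemma derivable_on_continuous g :
  (forall x, x \in `[a, b] -> derivable_on a b g x) ->
  {within `[a, b], continuous g}.
Proof.
move=> dg; apply/subspace_continuousP => x xab.
have {}dg := dg x xab.
have cl : (g y - g x) / (y - x) * (y - x) + g x @[y --> within `[a, b] x^'] -->
    derive_on a b g x * (x - x) + g x.
  apply: (@cvgD _ R^o); last exact: cvg_cst.
  apply: cvgM; first exact: dg.
  apply: (@cvgB _ R^o); last exact: cvg_cst.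
  by apply: cvg_within_filter; apply: cvg_within_filter; exact: cvg_id.
apply/(@cvgrPdist_lt _ R^o) => e e0.
move: cl => /(@cvgrPdist_lt _ R^o)/(_ e e0); rewrite subrr mulr0 add0r.
move=> H1; have {}H1 : nbhs x (fun t => t != x -> `[a, b]%classic t ->
    `|g x - ((g t - g x) / (t - x) * (t - x) + g x)| < e) := H1.
rewrite near_withinE; near=> y => yab.
have [->|yx] := eqVneq y x; first by rewrite subrr normr0.
suff : `|g x - ((g y - g x) / (y - x) * (y - x) + g x)| < e.
  by rewrite divfK ?subr_eq0// subrK.
by apply: (near H1 y).
Unshelve. all: by end_near. Qed.

Lemma continuous_segment_bounded g : {within `[a, b], continuous g} ->
  exists2 M : R, 0 < M & forall x, x \in `[a, b] -> `|g x| <= M.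
Proof.
move=> cg; have cNg : {within `[a, b], continuous (\- g)}.
  by move=> x; apply: (@continuousN _ R^o); exact: cg.
have [c _ cM] := EVT_max (ltW ab) cg; have [d _ dM] := EVT_max (ltW ab) cNg.
exists (`|g c| + `|g d| + 1) => [|x xab]; first by rewrite ltr_wpDl.
rewrite ler_norml; have := cM x xab; have := dM x xab => /=.
have := ler_norm (g c); have := ler_norm (- g d); rewrite normrN.
have := normr_ge0 (g c); have := normr_ge0 (g d).
by move=> *; apply/andP; split; lra.
Qed.

Lemma lipschitz_abs_continuous_on g (M : R) :
  (forall x y, a <= x -> x < y -> y <= b -> `|g y - g x| <= M * (y - x)) ->
  abs_continuous_on a b g.
Proof.
move=> lip e e0; have M0 : 0 <= M.
  have := lip a b (lexx a) ab (lexx b); move/(le_trans (normr_ge0 _)).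
  by rewrite pmulr_lge0 ?subr_gt0.
have M1 : 0 < M + 1 by rewrite ltr_wpDl.
exists (e / (M + 1)); first exact: divr_gt0.
move=> N u v uv _; rewrite ltr_pdivlMr// => uvd; apply: le_lt_trans uvd.
rewrite mulr_suml; apply: ler_sum => i _; have [au uvi vb] := uv i.
apply: le_trans (lip _ _ au uvi vb) _; rewrite mulrC.
by rewrite ler_wpM2l ?lerDl// subr_ge0 ltW.
Qed.

(** The mean value theorem makes [g] Lipschitz with constant [M]. *)
Lemma derivable_on_abs_continuous g (M : R) :
  (forall x, x \in `[a, b] -> derivable_on a b g x) ->
  (forall x, x \in `[a, b] -> `|derive_on a b g x| <= M) ->
  abs_continuous_on a b g.
Proof.
move=> dg bM; apply: (@lipschitz_abs_continuous_on _ M) => x y ax xy yb.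
have cg : {within `[x, y], continuous g}.
  apply: continuous_subspaceW (derivable_on_continuous dg).
  by apply: subset_itv; rewrite bnd_simp.
have dg' z : z \in `]x, y[ -> is_derive z 1 g (derive_on a b g z).
  rewrite in_itv/= => /andP[xz zy]; apply: derivable_on_is_derive.
    by rewrite in_itv/= (le_lt_trans ax xz) (lt_le_trans zy yb).
  by apply: dg; rewrite in_itv/= ltW ?(le_lt_trans ax xz)// ltW// (lt_le_trans zy yb).
have [c] := MVT xy dg' cg; rewrite in_itv/= => /andP[xc cy] ->.
rewrite normrM [X in _ * X]gtr0_norm ?subr_gt0// ler_wpM2r ?subr_ge0 ?(ltW xy)//.
apply: bM.
by rewrite in_itv/= ltW ?(le_lt_trans ax xc)// ltW// (lt_le_trans cy yb).
Qed.

Lemma abs_continuous_on_bounded g : abs_continuous_on a b g ->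
  exists2 M : R, 0 < M & forall x, x \in `[a, b] -> `|g x| <= M.
Proof. by move=> /abs_continuous_on_continuous/continuous_segment_bounded. Qed.

Lemma abs_continuous_onM f g : abs_continuous_on a b f ->
  abs_continuous_on a b g -> abs_continuous_on a b (fun x => f x * g x).
Proof.
move=> acf acg e e0.
have [Mf Mf0 bf] := abs_continuous_on_bounded acf.
have [Mg Mg0 bg] := abs_continuous_on_bounded acg.
have [d d0 Hf] := acf (e / 2 / Mg) (divr_gt0 (divr_gt0 e0 (ltr0n R 2)) Mg0).
have [d' d'0 Hg] := acg (e / 2 / Mf) (divr_gt0 (divr_gt0 e0 (ltr0n R 2)) Mf0).
exists (Num.min d d') => [|N u v uv tr]; first by rewrite lt_min d0.
rewrite lt_min => /andP[ud ud'].
apply: (@le_lt_trans _ _ (\sum_(i < N) (Mg * `|f (v i) - f (u i)| +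
                                        Mf * `|g (v i) - g (u i)|))).
  apply: ler_sum => i _; have [au uvi vb] := uv i.
  have -> : f (v i) * g (v i) - f (u i) * g (u i) =
    (f (v i) - f (u i)) * g (v i) + f (u i) * (g (v i) - g (u i)) by ring.
  apply: le_trans (ler_normD _ _) _; rewrite !normrM lerD//.
    rewrite mulrC ler_wpM2r// bg// in_itv/= vb andbT.
    exact: le_trans au (ltW uvi).
  rewrite ler_wpM2r// bf// in_itv/= au /=.
  exact: le_trans (ltW uvi) vb.
rewrite big_split/= [ltRHS]splitr ltrD// -mulr_sumr mulrC -ltr_pdivlMr//.
  exact: Hf.
exact: Hg.
Qed.

Lemma abs_continuous_on_horner p : abs_continuous_on a b (horner p).
Proof.
have [M M0 bM] : exists2 M : R, 0 < M & forall x, x \in `[a, b] -> `|p^`().[x]| <= M.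
  apply: continuous_segment_bounded; apply: continuous_subspaceT.
  exact: continuous_horner.
have dp x : x \in `[a, b] -> is_derive x 1 (horner p) p^`().[x] by move=> _; exact: is_derive_poly.
apply: (@derivable_on_abs_continuous _ M) => x xab.
  by have [] := is_derive_derive_on xab (dp x xab).
by have [_ ->] := is_derive_derive_on xab (dp x xab); exact: bM.
Qed.

End derivatives_relative_to_a_segment.

(** * Integration by parts for absolutely continuous functions *)

Lemma ae_eq_integrable (d : measure_display) (T : measurableType d) (R : realType)
    (mu : {measure set T -> \bar R}) (D : set T) (f g : T -> \bar R) :
  measurable D -> measurable_fun D g -> ae_eq mu D f g ->
  mu.-integrable D f -> mu.-integrable D g.
Proof.
move=> mD mg fg /integrableP[mf ifoo]; apply/integrableP; split => //.
have <- : (\int[mu]_(x in D) `|f x| = \int[mu]_(x in D) `|g x|)%E; last exact: ifoo.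
apply: ae_eq_integral => //; [exact: measurableT_comp|exact: measurableT_comp|].
by apply: filterS fg => x /[apply] /= ->.
Qed.

Section integration_by_parts.
Context {R : realType}.
Variables (a b : R).
Hypothesis ab : a < b.
Implicit Types (f g : R -> R) (p : {poly R}).
Local Notation mu := (@lebesgue_measure R).

Let ae_filter : Filter (nbhs (almost_everywhere mu)).
Proof. exact: (ae_filter_ringOfSetsType mu). Qed.
#[local] Existing Instance ae_filter.

(** With [h] the density of [g], Lebesgue differentiation gives the primitive of [h] the derivative
    [h] almost everywhere, and [g] differs from this primitive by the constant [g a] on [[a, b]]. *)
Lemma abs_continuous_on_FTC g : abs_continuous_on a b g ->
  exists h : R -> R, [/\ mu.-integrable setT (EFin \o h),
    forall x, x \in `[a, b] -> g x - g a = \int[mu]_(t in `[a, x]) h t &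
    {ae mu, forall x : R, x \in `]a, b[ -> is_derive x 1 g (h x)}].
Proof.
move=> acg; have [h ih hE] := abs_continuous_density ab acg; exists h; split=> //.
have ihy (y : R) : mu.-integrable [set` Interval (BLeft a) (BRight y)] (EFin \o h).
  exact: integrableS ih.
have lih : locally_integrable setT h.
  by apply: open_integrable_locally => //; exact: openT.
have := FTC1 ihy lih; apply: filterS => x + xab.
have [ax xb] : a < x /\ x < b by move: xab; rewrite in_itv/= => /andP[].
move=> H; have [|dF FE] := H; first by rewrite lte_fin.
set F := (fun x => _) in dF FE.
have dF' : is_derive x 1 F (h x).
  by apply: DeriveDef; [exact: dF|rewrite -derive1E FE].
apply: (@near_eq_is_derive _ _ _ (cst (g a) + F)); last first.
  by rewrite -[h x]add0r; exact: is_deriveD.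
near=> y; have : y \in `]a, b[ by near: y; exact: near_in_itvoo.
rewrite in_itv/= => /andP[ay yb].
by rewrite /F !fctE -hE ?subrKC// in_itv/= !ltW.
Unshelve. all: by end_near. Qed.

Lemma continuous_segment_integrable g c d : a <= c -> d <= b ->
  {within `[a, b], continuous g} -> mu.-integrable `[c, d] (EFin \o g).
Proof.
move=> ac db cg; apply: continuous_compact_integrable; first exact: segment_compact.
by apply: continuous_subspaceW cg; apply: subset_itv; rewrite bnd_simp.
Qed.

Lemma ae_eq_segment (c d : R) f g : a <= c -> d <= b ->
  {ae mu, forall x : R, x \in `]a, b[ -> f x = g x} ->
  ae_eq mu `[c, d]%classic (EFin \o f) (EFin \o g).
Proof.
move=> ac db fg.
have na : {ae mu, forall x : R, x != a}.
  exists [set a]; split=> //; first exact: lebesgue_measure_set1.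
  by move=> x /=/negP; rewrite negbK => /eqP.
have nb : {ae mu, forall x : R, x != b}.
  exists [set b]; split=> //; first exact: lebesgue_measure_set1.
  by move=> x /=/negP; rewrite negbK => /eqP.
apply: filterS3 na nb fg => x xa xb fgx; rewrite /= in_itv/= => /andP[cx xd].
congr EFin; apply: fgx; rewrite in_itv/= lt_neqAle eq_sym xa (le_trans ac cx)/=.
by rewrite lt_neqAle xb (le_trans xd db).
Qed.

(** The product [phi = p g] is absolutely continuous, and almost everywhere its density is
    [p' g + p g']. Integrating that density over [[c, d]] gives [phi d - phi c]. *)
Lemma segment_integration_by_parts g p c d : abs_continuous_on a b g ->
  measurable_fun (`[a, b] : set (measurableTypeR R)) (derive_on a b g) ->
  a <= c -> c <= d -> d <= b ->
  mu.-integrable `[c, d] (EFin \o (fun x => p.[x] * derive_on a b g x)) /\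
  \int[mu]_(x in `[c, d]) (p.[x] * derive_on a b g x) =
    p.[d] * g d - p.[c] * g c - \int[mu]_(x in `[c, d]) (p^`().[x] * g x).
Proof.
move=> acg mg ac cd db; pose D := derive_on a b g.
have sub : `[c, d] `<=` `[a, b] by apply: subset_itv; rewrite bnd_simp.
have mcd : measurable (`[c, d]%classic : set (measurableTypeR R)).
  exact: measurable_itv.
have cg := abs_continuous_on_continuous acg.
have cp (q : {poly R}) : {within `[a, b], continuous (horner q)}.
  by apply: continuous_subspaceT; exact: continuous_horner.
pose phi x := p.[x] * g x.
have acphi : abs_continuous_on a b phi.
  by apply: abs_continuous_onM => //; exact: abs_continuous_on_horner.
have [hg [_ _ dg]] := abs_continuous_on_FTC acg.
have [h [ih hE dphi]] := abs_continuous_on_FTC acphi.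
pose q x := p^`().[x] * g x.
have cq : {within `[a, b], continuous q}.
  by move=> x; apply: (@continuousM _ (subspace `[a, b])); [exact: cp|exact: cg].
have iq : mu.-integrable `[c, d] (EFin \o q) by exact: continuous_segment_integrable.
have mpD : measurable_fun (`[c, d] : set (measurableTypeR R)) (fun x => p.[x] * D x).
  apply: measurable_funM; last exact: measurable_funS mg.
  by apply: measurable_funTS; apply: measurable_realfun.continuous_measurable_fun;
    exact: continuous_horner.
have aeh : {ae mu, forall x : R, x \in `]a, b[ -> h x - q x = p.[x] * D x}.
  apply: filterS2 dg dphi => x dg dphi xab.
  have xab' : x \in `[a, b] by move: xab; rewrite !in_itv/= => /andP[/ltW -> /ltW ->].
  have [_ DE] := is_derive_derive_on ab xab' (dg xab).
  have /(@derive_val _ _ _ _ _ _ _) := dphi xab.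
  have dpg := is_deriveM (is_derive_poly p x) (dg xab).
  have -> : 'D_1 phi x = p.[x] *: hg x + g x *: p^`().[x] by exact: derive_val.
  by move=> <-; rewrite /D DE /q /GRing.scale/=; ring.
have ih' : mu.-integrable `[c, d] (EFin \o h) by exact: integrableS ih.
have ihq : mu.-integrable `[c, d] (EFin \o (fun x => h x - q x)).
  by have := integrableB mcd ih' iq; apply: eq_integrable.
have aeq := ae_eq_segment ac db aeh.
have ipD : mu.-integrable `[c, d] (EFin \o (fun x => p.[x] * D x)).
  by apply: ae_eq_integrable ihq => //; exact/measurable_EFinP.
split=> //.
have -> : \int[mu]_(x in `[c, d]) (p.[x] * derive_on a b g x) =
    \int[mu]_(x in `[c, d]) (h x - q x).
  congr fine; apply: ae_eq_integral => //.
  - exact/measurable_EFinP.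
  - exact: measurable_int ihq.
  - by apply: filterS aeq => x /[apply] /esym.
rewrite RintegralB//; congr (_ - _).
have ih'' : mu.-integrable `[a, d] (EFin \o h) by exact: integrableS ih.
rewrite -[LHS]Rintegral_itv_obnd_cbnd; last first.
  by apply: integrableS ih' => //; apply: subset_itv; rewrite bnd_simp.
rewrite -(Rintegral_itvB ih'') ?bnd_simp// -!hE /phi ?in_itv/= ?ac ?db ?(le_trans ac cd)//.
  by ring.
by rewrite (le_trans cd db).
Qed.

End integration_by_parts.

Section iterated_integration_by_parts.
Context {R : realType}.
Variables (a b : R) (n : nat) (f : R -> R).
Hypotheses (ab : a < b) (admf : admissible a b n f).
Implicit Types (p : {poly R}).
Local Notation mu := (@lebesgue_measure R).

(** Descending induction from [n.-1], where it is part of admissibility: the derivative of order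
    [k.+1] is absolutely continuous, hence bounded, so the one of order [k] is Lipschitz. *)
Lemma admissible_abs_continuous k : (k < n)%N ->
  abs_continuous_on a b (deriven_on a b k f).
Proof.
have [df acf _] := admf.
elim/ltn_ind: {k}(n.-1 - k)%N {-2}k (erefl (n.-1 - k)%N) => i IH k ki kn.
have [kn1|] := ltnP k n.-1; last first.
  by move=> nk; have -> : k = n.-1 by lia.
have [M M0 bM] : exists2 M : R, 0 < M & forall x, x \in `[a, b] ->
    `|deriven_on a b k.+1 f x| <= M.
  apply: abs_continuous_on_bounded => //; apply: (IH (n.-1 - k.+1)%N); lia.
by apply: (@derivable_on_abs_continuous _ a b ab _ M) => //; exact: df.
Qed.

Lemma L2_on_measurable (g : R -> R) : L2_on a b g ->
  measurable_fun (`[a, b]%classic : set (measurableTypeR R)) g.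
Proof.
rewrite /L2_on inE => /andP[mg _]; apply/(measurable_restrictT _) => //.
by move: mg; rewrite inE.
Qed.

Lemma admissible_measurable k : (k <= n)%N ->
  measurable_fun (`[a, b]%classic : set (measurableTypeR R)) (deriven_on a b k f).
Proof.
rewrite leq_eqVlt => /predU1P[->|kn].
  by have [_ _] := admf; exact: L2_on_measurable.
apply: subspace_continuous_measurable_fun => //.
exact/abs_continuous_on_continuous/admissible_abs_continuous.
Qed.

(** Stated on a subinterval [[c, d]] because the Peano kernel is a polynomial only on each half of
    [[a, b]]. *)
Lemma iterated_integration_by_parts p c d j : a <= c -> c <= d -> d <= b ->
  (j <= n)%N ->
  \int[mu]_(x in `[c, d]) (p.[x] * deriven_on a b n f x) =
  \sum_(k < j) (-1) ^+ k * (p^`(k).[d] * deriven_on a b (n - k.+1) f d -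
                            p^`(k).[c] * deriven_on a b (n - k.+1) f c) +
  (-1) ^+ j * \int[mu]_(x in `[c, d]) (p^`(j).[x] * deriven_on a b (n - j) f x).
Proof.
move=> ac cd db; elim: j => [_|j IH jn].
  by rewrite big_ord0 add0r expr0 mul1r subn0.
rewrite (IH (ltnW jn)) big_ord_recr/= -addrA; congr (_ + _).
have nj : (n - j)%N = (n - j.+1).+1 by lia.
have acj : abs_continuous_on a b (deriven_on a b (n - j.+1) f).
  by apply: admissible_abs_continuous; lia.
have mj : measurable_fun (`[a, b]%classic : set (measurableTypeR R))
    (derive_on a b (deriven_on a b (n - j.+1) f)).
  rewrite -[derive_on a b _]/(deriven_on a b (n - j.+1).+1 f) -nj.
  by apply: admissible_measurable; lia.
have [_] := segment_integration_by_parts ab p^`(j) acj mj ac cd db.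
rewrite -[derive_on a b _]/(deriven_on a b (n - j.+1).+1 f) -nj => ->.
by rewrite exprS; ring.
Qed.

(** The case [p = 1], [j = 1] of the iterated formula: the remaining integrand has the factor
    [p' = 0]. *)
Lemma admissible_FTC : (0 < n)%N ->
  \int[mu]_(x in `[a, b]) deriven_on a b n f x =
  deriven_on a b n.-1 f b - deriven_on a b n.-1 f a.
Proof.
move=> n0.
have := @iterated_integration_by_parts 1 a b 1 (lexx a) (ltW ab) (lexx b) n0.
rewrite big_ord1 expr0 derivn0 expr1 derivn1 derivC.
under eq_Rintegral do rewrite hornerC mul1r.
move=> ->; under eq_Rintegral do rewrite horner0 mul0r.
by rewrite Rintegral_cst//= mul0r mulr0 addr0 !hornerC !mul1r subn1.
Qed.

End iterated_integration_by_parts.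

(** * The Peano kernel *)

Section taylor_monomials.
Context {R : realType}.
Local Notation mu := (@lebesgue_measure R).

Definition taylor_monomial (N : nat) (c : R) : {poly R} :=
  (N`!%:R)^-1 *: ('X - c%:P) ^+ N.

(** One half of the Peano kernel when [c] is an endpoint and [t] is [theta h] up to sign;
    differentiating lowers [N], so all the derivatives keep this form down to [N = 1]. *)
Definition kernel_poly (N : nat) (c t : R) : {poly R} :=
  taylor_monomial N c - t *: taylor_monomial N.-1 c.

Lemma horner_taylor_monomial N (c x : R) :
  (taylor_monomial N c).[x] = (x - c) ^+ N / N`!%:R.
Proof. by rewrite hornerZ horner_exp hornerXsubC mulrC. Qed.

Lemma deriv_taylor_monomial N (c : R) :
  (taylor_monomial N.+1 c)^`() = taylor_monomial N c.
Proof.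
rewrite /taylor_monomial derivZ deriv_exp derivXsubC mul1r -[_ ^+ _ *+ _]scaler_nat scalerA.
congr (_ *: _).
rewrite factS natrM; field.
by rewrite pnatr_eq0 -lt0n fact_gt0 nat1r pnatr_eq0.
Qed.

Lemma derivn_taylor_monomial N k (c : R) :
  (taylor_monomial (k + N) c)^`(k) = taylor_monomial N c.
Proof.
elim: k N => // k IH N.
by rewrite derivSn addSn deriv_taylor_monomial IH.
Qed.

Lemma taylor_monomial0 (c : R) : taylor_monomial 0 c = 1.
Proof. by rewrite /taylor_monomial expr0 fact0 invr1 scale1r. Qed.

Lemma derivn_kernel_poly N k (c t : R) : (k < N)%N ->
  (kernel_poly N c t)^`(k) = kernel_poly (N - k) c t.
Proof.
move=> kN.
have dT M : (k <= M)%N -> (taylor_monomial M c)^`(k) = taylor_monomial (M - k) c.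
  by move=> kM; rewrite -{1}(subnKC kM) derivn_taylor_monomial.
rewrite /kernel_poly derivnB dT 1?ltnW// [(t *: _)^`(k)]derivnZ dT; last by lia.
by have -> : (N.-1 - k = (N - k).-1)%N by lia.
Qed.

Lemma derivn_kernel_polyN N (c t : R) : (0 < N)%N -> (kernel_poly N c t)^`(N) = 1.
Proof.
case: N => // N _; rewrite derivnS derivn_kernel_poly// subSnn /kernel_poly.
rewrite derivB deriv_taylor_monomial [(t *: _)^`()]derivZ /= taylor_monomial0.
by rewrite -polyC1 derivC scaler0 subr0.
Qed.

Lemma horner_kernel_poly N (c t x : R) : (kernel_poly N c t).[x] =
  (x - c) ^+ N / N`!%:R - t * ((x - c) ^+ N.-1 / N.-1`!%:R).
Proof.
by rewrite hornerD hornerN [(t *: _).[x]]hornerZ !horner_taylor_monomial.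
Qed.

Lemma Rintegral_segment_cat (f : R -> R) (c d e : R) : c <= d -> d <= e ->
  mu.-integrable `[c, e] (EFin \o f) ->
  \int[mu]_(x in `[c, e]) f x = \int[mu]_(x in `[c, d]) f x + \int[mu]_(x in `[d, e]) f x.
Proof.
move=> cd de intf; have := Rintegral_itvB intf (x := d).
rewrite !bnd_simp => /(_ cd de) /eqP; rewrite subr_eq => /eqP ->.
rewrite addrC Rintegral_itv_obnd_cbnd//.
by apply: integrableS intf => //; apply: subset_itv; rewrite bnd_simp.
Qed.

Lemma Rintegral_deriv_horner (p : {poly R}) (c d : R) : c <= d ->
  \int[mu]_(x in `[c, d]) p^`().[x] = p.[d] - p.[c].
Proof.
rewrite le_eqVlt => /predU1P[->|cd]; first by rewrite set_itv1 Rintegral_set1 subrr.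
rewrite /Rintegral (@continuous_FTC2 _ _ (horner p))//.
- by apply: continuous_subspaceT; exact: continuous_horner.
- split; first by move=> x _; apply: ex_derive; exact: is_derive_poly.
  + by apply: cvg_at_right_filter; exact: continuous_horner.
  + by apply: cvg_at_left_filter; exact: continuous_horner.
- move=> x _; rewrite derive1E; apply: derive_val; exact: is_derive_poly.
Qed.

Lemma alternating_sum_even (N : nat) (G : nat -> R) :
  \sum_(k < 2 * N) (1 + (-1) ^+ k) * G k = 2 * \sum_(0 <= i < N) G (2 * i)%N.
Proof.
elim: N => [|N IH]; first by rewrite muln0 big_ord0 big_geq// mulr0.
rewrite (_ : 2 * N.+1 = (2 * N).+2)%N; last by lia.
rewrite !big_ord_recr/= IH big_nat_recr//=.
by rewrite exprS -signr_odd mul2n odd_double expr0; ring.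
Qed.

End taylor_monomials.

Section peano_kernel.
Context {R : realType}.
Variables (a b : R) (m : nat) (theta : R).
Hypotheses (ab : a < b) (m0 : (0 < m)%N).
Local Notation mu := (@lebesgue_measure R).
Local Notation n := (2 * m)%N.
Local Notation h := ((b - a) / 2).
Local Notation mid := ((a + b) / 2).

Definition left_kernel : {poly R} := kernel_poly n a (theta * h).
(** As [n] is even, passing from [a], [theta h] to [b], [- theta h] reflects the left kernel in the
    midpoint. *)
Definition right_kernel : {poly R} := kernel_poly n b (- (theta * h)).

(* Both pieces agree at the midpoint, so this is the left one up to the midpoint and the
   right one after it; in this form continuity is immediate. *)
Definition peano_kernel (x : R) : R :=
  left_kernel.[Num.min x mid] + right_kernel.[Num.max x mid] - left_kernel.[mid].

Lemma mid_subl : mid - a = h. Proof. by field. Qed.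
Lemma mid_subr : mid - b = - h. Proof. by field. Qed.
Lemma mid_ge : a <= mid. Proof. by move: ab; lra. Qed.
Lemma mid_le : mid <= b. Proof. by move: ab; lra. Qed.

(** Each derivation of a reflected function contributes a sign. The case [k = 0] gives continuity;
    the others pair the boundary terms at the midpoint. *)
Lemma derivn_kernel_mid k : (k < n)%N ->
  right_kernel^`(k).[mid] = (-1) ^+ k * left_kernel^`(k).[mid].
Proof.
move=> kn; rewrite !derivn_kernel_poly// !horner_kernel_poly mid_subl mid_subr.
have [j nkE] : exists j, (n - k)%N = j.+1 by exists (n - k).-1; lia.
rewrite nkE /= -[- h]mulN1r !exprMn -[(-1) ^+ k]signr_odd -[(-1) ^+ j.+1]signr_odd.
rewrite -[(-1) ^+ j]signr_odd.
have -> : odd j.+1 = odd k.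
  by rewrite -nkE oddB ?(ltnW kn)// mul2n odd_double.
have -> : odd j = ~~ odd k.
  by have := congr1 odd nkE; rewrite oddB ?(ltnW kn)// mul2n odd_double /= => ->; rewrite negbK.
by case: (odd k) => /=; rewrite ?expr0 ?expr1; ring.
Qed.

Lemma kernel_mid : right_kernel.[mid] = left_kernel.[mid].
Proof.
by have := @derivn_kernel_mid 0; rewrite expr0 mul1r !derivn0; apply; lia.
Qed.

Lemma peano_kernel_left x : x <= mid -> peano_kernel x = left_kernel.[x].
Proof.
by move=> xm; rewrite /peano_kernel (min_idPl xm) (max_idPr xm) kernel_mid addrK.
Qed.

Lemma peano_kernel_right x : mid <= x -> peano_kernel x = right_kernel.[x].
Proof.
by move=> mx; rewrite /peano_kernel (min_idPr mx) (max_idPl mx) addrAC subrr add0r.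
Qed.

Lemma peano_kernel_continuous : continuous peano_kernel.
Proof.
move=> x; apply: (@cvgB _ R^o); last exact: cvg_cst.
apply: (@cvgD _ R^o).
  apply: (@continuous_comp _ _ _ (fun x => Num.min x mid)); last exact: continuous_horner.
  by apply: continuous_min; [exact: cvg_id|exact: cst_continuous].
apply: (@continuous_comp _ _ _ (fun x => Num.max x mid)); last exact: continuous_horner.
by apply: continuous_max; [exact: cvg_id|exact: cst_continuous].
Qed.

Lemma peano_kernel_integralM (g : R -> R) :
  mu.-integrable `[a, b] (EFin \o (fun x => peano_kernel x * g x)) ->
  integral_on a b (fun x => peano_kernel x * g x) =
  \int[mu]_(x in `[a, mid]) (left_kernel.[x] * g x) +
  \int[mu]_(x in `[mid, b]) (right_kernel.[x] * g x).
Proof.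
move=> intg; rewrite /integral_on (Rintegral_segment_cat mid_ge mid_le intg).
congr (_ + _); apply: eq_Rintegral => x; rewrite inE/= in_itv/= => /andP[x1 x2].
  by rewrite peano_kernel_left.
by rewrite peano_kernel_right.
Qed.

(** The value at the midpoint of the left kernel's derivative of order [n - l.+1], which multiplies
    [f^(l)] in the boundary terms. For [l = 2i] with [i > 0] it is half the coefficient of [f^(2i)]
    in [F_n]. *)
Definition mid_weight (l : nat) : R := h ^+ l.+1 * (1 - theta * l.+1%:R) / l.+1`!%:R.

Lemma derivn_left_kernel_mid k : (k < n)%N ->
  left_kernel^`(k).[mid] = mid_weight (n - k.+1).
Proof.
move=> kn; rewrite derivn_kernel_poly// horner_kernel_poly mid_subl.
have -> : (n - k = (n - k.+1).+1)%N by lia.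
rewrite /mid_weight factS natrM exprS; field.
by rewrite nat1r !pnatr_eq0 -lt0n fact_gt0.
Qed.

(** At [c] only the order [k = n - 1] survives; it accompanies [f] itself and yields the terms in
    [f a] and [f b]. *)
Lemma derivn_kernel_self k (c t : R) : (k < n)%N ->
  (kernel_poly n c t)^`(k).[c] = - t * (n - k.+1 == 0)%N%:R.
Proof.
move=> kn; rewrite derivn_kernel_poly// horner_kernel_poly subrr.
have -> : (n - k = (n - k.+1).+1)%N by lia.
rewrite /= expr0n /= mul0r sub0r expr0n.
case: eqVneq => [->|_]; first by rewrite fact0 divr1 mulNr.
by rewrite mul0r !mulr0 oppr0.
Qed.

Variable f : R -> R.
Hypothesis admf : admissible a b n f.
Local Notation D k := (deriven_on a b k f).

Lemma peano_kernel_identity :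
  mu.-integrable `[a, b] (EFin \o (fun x => peano_kernel x * D n x)) ->
  integral_on a b (fun x => peano_kernel x * D n x) =
  integral_on a b f - quadrature a b n theta f.
Proof.
move=> intS; rewrite peano_kernel_integralM//.
have n0 : (0 < n)%N by lia.
have intf : mu.-integrable `[a, b] (EFin \o f).
  apply: (@continuous_segment_integrable _ a b) => //.
  apply: abs_continuous_on_continuous => //.
  exact: (admissible_abs_continuous ab admf n0).
rewrite (iterated_integration_by_parts ab admf left_kernel (lexx a) mid_ge mid_le (leqnn n)).
rewrite (iterated_integration_by_parts ab admf right_kernel mid_ge mid_le (lexx b) (leqnn n)).
rewrite !derivn_kernel_polyN// subnn.
have sgn : (-1) ^+ n = 1 :> R by rewrite -signr_odd mul2n odd_double.
rewrite sgn !mul1r.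
have i1 c d : \int[mu]_(x in `[c, d]) ((1 : {poly R}).[x] * D 0 x) = \int[mu]_(x in `[c, d]) f x.
  by apply: eq_Rintegral => x _; rewrite hornerC mul1r.
rewrite !i1.
rewrite /integral_on (Rintegral_segment_cat mid_ge mid_le intf).
rewrite addrACA [LHS]addrC; congr (_ + _).
rewrite -big_split/=.
(* [F l] collects all boundary terms with [f^(l)]: both halves meet at the midpoint, where odd
   orders cancel, and the endpoints count only for [l = 0]. *)
pose F l := (1 + (-1) ^+ l) * (mid_weight l * D l mid) +
  (l == 0%N)%:R * (theta * h * (D l a + D l b)).
rewrite (eq_bigr (fun k : 'I_n => - F (n - k.+1)%N)); last first.
  move=> [k kn] _ /=; rewrite derivn_kernel_mid// derivn_left_kernel_mid//.
  rewrite !derivn_kernel_self// /F.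
  (* [k] and [n - k.+1] have opposite parity because [n] is even. *)
  have sk : (-1) ^+ k = - (-1) ^+ (n - k.+1) :> R.
    rewrite -[LHS]signr_odd -[in RHS]signr_odd oddB// mul2n odd_double /=.
    by case: (odd k) => /=; rewrite ?expr0 ?expr1 ?opprK.
  have ss : (-1) ^+ (n - k.+1) * (-1) ^+ (n - k.+1) = 1 :> R.
    by rewrite -signr_odd; case: odd; rewrite ?expr0 ?expr1; ring.
  rewrite sk; move: ss; case: eqVneq => [->|_]; first by rewrite expr0 => _; ring.
  move: ((-1) ^+ _) => s ss.
  rewrite !mulr0 !mul0r addr0 sub0r subr0.
  transitivity (- s * (mid_weight (n - k.+1) * D (n - k.+1) mid) -
    (s * s) * (mid_weight (n - k.+1) * D (n - k.+1) mid)); first by ring.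
  by rewrite ss; ring.
rewrite sumrN; congr (- _).
rewrite (reindex_inj rev_ord_inj)/= (eq_bigr (fun k : 'I_n => F k)); last first.
  by move=> k _; congr F; have := ltn_ord k; lia.
rewrite big_split/= (alternating_sum_even m (fun l => mid_weight l * D l mid)).
have -> : \sum_(k < n) (k == 0%N :> nat)%:R * (theta * h * (D k a + D k b)) =
    theta * h * (f a + f b).
  rewrite (bigD1 (Ordinal n0))//= mul1r big1 ?addr0// => k.
  by rewrite -val_eqE /= => /negbTE ->; rewrite mul0r.
(* The term [i = 0] is the value of [f] at the midpoint, which [quadrature] keeps outside its
   sum. *)
rewrite big_ltn// muln0 /quadrature.
have -> : ((n - 1) %/ 2).+1 = m by lia.
rewrite mulrDr mulr_sumr addrAC; congr (_ + _).
  by rewrite /mid_weight expr1 (_ : 1`! = 1)%N// divr1 mulr1 /deriven_on/=; field.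
apply: eq_bigr => i _; rewrite /mid_weight addn1 mulrA; congr (_ * _).
rewrite expr_div_n exprS [2 ^+ _.+1]exprS; field.
by rewrite expf_neq0// pnatr_eq0 -lt0n fact_gt0.
Qed.

End peano_kernel.

(** * Variance and the Cauchy-Schwarz inequality *)

Section segment_variance.
Context {R : realType}.
Variables (a b : R).
Hypothesis ab : a < b.
Local Notation mu := (@lebesgue_measure R).
Local Notation integrable_on g := (mu.-integrable `[a, b] (EFin \o g)).

Let mAB : measurable (`[a, b]%classic : set (measurableTypeR R)).
Proof. exact: measurable_itv. Qed.

Let muAB : mu `[a, b]%classic = (b - a)%:E.
Proof. by rewrite lebesgue_measure_itv/= lte_fin ab. Qed.

Lemma segment_integrable_cst (c : R) : integrable_on (fun=> c).
Proof.
apply: continuous_compact_integrable; first exact: segment_compact.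
by apply: continuous_subspaceT => x; exact: cst_continuous.
Qed.

Lemma segment_integral_lin (c : R) (f g : R -> R) :
  integrable_on f -> integrable_on g ->
  integrable_on (fun x => c * f x + g x) /\
  integral_on a b (fun x => c * f x + g x) =
    c * integral_on a b f + integral_on a b g.
Proof.
move=> intf intg.
have intcf : integrable_on (fun x => c * f x).
  by have := integrableZl mAB c intf; apply: eq_integrable.
split; first by have := integrableD mAB intcf intg; apply: eq_integrable.
by rewrite /integral_on RintegralD// RintegralZl.
Qed.

Lemma segment_integral_cst (c : R) : integral_on a b (fun=> c) = c * (b - a).
Proof. by rewrite /integral_on Rintegral_cst//; congr (c * _); rewrite [X in fine X]muAB. Qed.

(** Not divided by [b - a]: this is the symmetric bilinear form attached to [sigma_on]. *)
Definition covariance_on (f g : R -> R) : R :=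
  integral_on a b (fun x => f x * g x) -
  (b - a)^-1 * integral_on a b f * integral_on a b g.

(** Take [s = w], [t = - v] when [w > 0]. When [w = 0], the choice [s = - v], [t = u + 1] gives
    [- v^2 (u + 2) >= 0], so [v = 0]. *)
Lemma quadratic_discriminant (u v w : R) :
  (forall s t : R, 0 <= s ^+ 2 * u + 2 * s * t * v + t ^+ 2 * w) -> v ^+ 2 <= u * w.
Proof.
move=> H; have w0 : 0 <= w by have := H 0 1; lra.
have u0 : 0 <= u by have := H 1 0; lra.
have [wp|w0'] := ltP 0 w.
  have := H w (- v).
  have -> : w ^+ 2 * u + 2 * w * (- v) * v + (- v) ^+ 2 * w = w * (u * w - v ^+ 2) by ring.
  by rewrite pmulr_rge0// subr_ge0.
have {}w0 : w = 0 by apply/eqP; rewrite eq_le w0' w0.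
have := H (- v) (u + 1); rewrite w0.
have -> : (- v) ^+ 2 * u + 2 * (- v) * (u + 1) * v + (u + 1) ^+ 2 * 0 =
  - (v ^+ 2 * (u + 2)) by ring.
rewrite oppr_ge0 pmulr_lle0 ?mulr0//; lra.
Qed.

Lemma covariance_quadratic_ge0 (f g : R -> R) (s t : R) :
  integrable_on f -> integrable_on g -> integrable_on (fun x => f x * f x) ->
  integrable_on (fun x => g x * g x) -> integrable_on (fun x => f x * g x) ->
  0 <= s ^+ 2 * covariance_on f f + 2 * s * t * covariance_on f g +
       t ^+ 2 * covariance_on g g.
Proof.
move=> intf intg intff intgg intfg.
(* The constant [r] makes [s f + t g + r] have mean zero. *)
pose r := - (s * integral_on a b f + t * integral_on a b g) / (b - a).
have [i1 e1] := segment_integral_lin (2 * t * r) intg (segment_integrable_cst (r ^+ 2)).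
have [i2 e2] := segment_integral_lin (2 * s * r) intf i1.
have [i3 e3] := segment_integral_lin (t ^+ 2) intgg i2.
have [i4 e4] := segment_integral_lin (2 * s * t) intfg i3.
have [i5 e5] := segment_integral_lin (s ^+ 2) intff i4.
move: e5; rewrite e4 e3 e2 e1 segment_integral_cst => e5.
have : 0 <= integral_on a b (fun x => (s * f x + t * g x + r) ^+ 2).
  by apply: Rintegral_ge0 => x _; exact: sqr_ge0.
have -> : integral_on a b (fun x => (s * f x + t * g x + r) ^+ 2) =
    integral_on a b (fun x => s ^+ 2 * (f x * f x) + (2 * s * t * (f x * g x) +
     (t ^+ 2 * (g x * g x) + (2 * s * r * f x + (2 * t * r * g x + r ^+ 2))))).
  by apply: eq_Rintegral => x _; ring.
rewrite e5 => /le_trans; apply; rewrite le_eqVlt; apply/orP; left; apply/eqP.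
rewrite /covariance_on /r; field.
by rewrite subr_eq0 gt_eqF.
Qed.

Lemma covariance_ge0 (f : R -> R) :
  integrable_on f -> integrable_on (fun x => f x * f x) -> 0 <= covariance_on f f.
Proof.
move=> intf intff; have := covariance_quadratic_ge0 1 0 intf intf intff intff intff.
by rewrite expr1n mul1r mulr0 !mul0r expr0n mul0r !addr0.
Qed.

Lemma covariance_Cauchy_Schwarz (f g : R -> R) :
  integrable_on f -> integrable_on g -> integrable_on (fun x => f x * f x) ->
  integrable_on (fun x => g x * g x) -> integrable_on (fun x => f x * g x) ->
  covariance_on f g ^+ 2 <= covariance_on f f * covariance_on g g.
Proof.
move=> intf intg intff intgg intfg; apply: quadratic_discriminant => s t.
exact: covariance_quadratic_ge0.
Qed.

Lemma L2_on_integrable_sqr (g : R -> R) : L2_on a b g ->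
  integrable_on (fun x => g x * g x).
Proof.
move=> /Lfun2_integrable_sqr/(integrableS measurableT mAB (@subsetT _ _)).
apply: eq_integrable => // x xab.
by rewrite /= patchE xab expr2.
Qed.

(** Domination [|g| <= g^2 + 1], which follows from [(|g| - 1/2)^2 >= 0]. *)
Lemma integrable_sqr_integrable (g : R -> R) :
  measurable_fun (`[a, b]%classic : set (measurableTypeR R)) g ->
  integrable_on (fun x => g x * g x) -> integrable_on g.
Proof.
move=> mg intgg; have [i _] := segment_integral_lin 1 intgg (segment_integrable_cst 1).
apply: le_integrable i => //; first exact/measurable_EFinP.
move=> x _ /=; rewrite lee_fin mul1r [leRHS]ger0_norm; last first.
  by rewrite addr_ge0// -expr2 sqr_ge0.
rewrite -expr2 -real_normK ?num_real//.
have := sqr_ge0 (`|g x| - 2^-1).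
have -> : (`|g x| - 2^-1) ^+ 2 = `|g x| ^+ 2 - `|g x| + 2^-1 ^+ 2 by field.
have : (2^-1 : R) ^+ 2 <= 1 by rewrite exprn_ile1 ?invr_ge0 ?invf_le1 ?ler1n.
lra.
Qed.

Lemma sigma_on_covariance (g : R -> R) : L2_on a b g ->
  sigma_on a b g = covariance_on g g.
Proof.
move=> Lg; rewrite /sigma_on /covariance_on mulrA -mulrA -expr2; congr (_ - _).
pose h := g \_ `[a, b].
have := @powR_Lnorm _ _ _ mu (EFin \o h) 2 (lt0r_neq0 (ltr0n R 2)).
move=> /(congr1 fine); rewrite fine_poweR powR_mulrn ?fine_ge0 ?Lnorm_ge0//.
rewrite /L2norm_on => ->; rewrite /integral_on Rintegral_mkcond.
congr fine; apply: eq_integral => x _ /=; rewrite powR_mulrn// real_normK ?num_real//.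
rewrite /h !patchE; case: ifPn => _; first by rewrite expr2.
by rewrite expr2 mulr0.
Qed.

End segment_variance.

(** * Mean and variance of the Peano kernel *)

Section peano_kernel_variance.
Context {R : realType}.
Variables (a b : R) (m : nat) (theta : R).
Hypotheses (ab : a < b) (m0 : (0 < m)%N).
Local Notation mu := (@lebesgue_measure R).
Local Notation n := (2 * m)%N.
Local Notation h := ((b - a) / 2).
Local Notation mid := ((a + b) / 2).
Local Notation S := (peano_kernel a b m theta).
Local Notation integrable_on g := (mu.-integrable `[a, b] (EFin \o g)).

Lemma peano_kernel_integrable : integrable_on S.
Proof.
apply: (continuous_segment_integrable (lexx a) (lexx b)).
by apply: continuous_subspaceT; exact: peano_kernel_continuous.
Qed.

Lemma peano_kernel_sqr_integrable : integrable_on (fun x => S x * S x).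
Proof.
apply: (continuous_segment_integrable (lexx a) (lexx b)).
apply: continuous_subspaceT => x.
by apply: continuousM; exact: peano_kernel_continuous.
Qed.

Lemma Rintegral_kernel_poly N (c t x y : R) : (0 < N)%N -> x <= y ->
  \int[mu]_(z in `[x, y]) (kernel_poly N c t).[z] =
  (kernel_poly N.+1 c t).[y] - (kernel_poly N.+1 c t).[x].
Proof.
move=> N0 xy; rewrite -Rintegral_deriv_horner//.
have := @derivn_kernel_poly _ N.+1 1 c t; rewrite ltnS => /(_ N0).
by rewrite derivn1 subSS subn0 => ->.
Qed.

(** The antiderivative, zero at [c], of the square of [kernel_poly k.+1 c t]; its middle coefficient
    comes from [2 / ((2k+2) k! (k+1)!) = 1 / (k+1)!^2]. *)
Definition kernel_sqr_primitive (k : nat) (c t : R) : {poly R} :=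
  (k.+1`!%:R ^+ 2 * (2 * k + 3)%:R)^-1 *: ('X - c%:P) ^+ (2 * k + 3) -
  (t / (k.+1`!%:R * k.+1`!%:R)) *: ('X - c%:P) ^+ (2 * k + 2) +
  (t ^+ 2 / (k`!%:R ^+ 2 * (2 * k + 1)%:R)) *: ('X - c%:P) ^+ (2 * k + 1).

Lemma Rintegral_kernel_poly_sqr k (c t x y : R) : x <= y ->
  \int[mu]_(z in `[x, y]) ((kernel_poly k.+1 c t).[z] * (kernel_poly k.+1 c t).[z]) =
  (kernel_sqr_primitive k c t).[y] - (kernel_sqr_primitive k c t).[x].
Proof.
move=> xy; rewrite -Rintegral_deriv_horner//; apply: eq_Rintegral => z _.
rewrite !horner_kernel_poly /= /kernel_sqr_primitive.
rewrite derivD derivB !derivZ !deriv_exp derivXsubC.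
rewrite !mul1r !(hornerD, hornerN, hornerZ, hornerMn, horner_exp).
rewrite hornerX hornerC; move: (z - c) => d.
rewrite !addn3 !addn2 !addn1 /= [d ^+ _.+2]exprS ![d ^+ _.+1]exprS.
have -> : d ^+ (2 * k) = d ^+ k * d ^+ k by rewrite mul2n -addnn exprD.
rewrite -[d * _ *+ (2 * k).+3]mulr_natl -[d * _ *+ (2 * k).+2]mulr_natl.
rewrite -[d ^+ k * _ *+ (2 * k).+1]mulr_natl.
have e1 : (2 * k).+1%:R = 2 * k%:R + 1 :> R by rewrite -natr1 natrM.
have e2 : (2 * k).+2%:R = 2 * k%:R + 2 :> R by rewrite -natr1 e1 -addrA.
have e3 : (2 * k).+3%:R = 2 * k%:R + 3 :> R by rewrite -natr1 e2 -addrA natr1.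
have k1 : k.+1%:R = k%:R + 1 :> R by rewrite natr1.
move: (d ^+ k) => w; rewrite factS natrM e1 e2 e3 k1.
have k0 : k`!%:R != 0 :> R by rewrite pnatr_eq0 -lt0n fact_gt0.
have kge : 0 <= k%:R :> R by rewrite ler0n.
move: (k`!%:R) (k%:R) k0 kge => F K F0 K0; field.
by rewrite F0 !lt0r_neq0//; lra.
Qed.

(** On each half [kernel_poly n.+1] is an antiderivative that vanishes at the outer endpoint.
    Multiplied by the mean of [f^(n)], this value is the correction term of the inequality. *)
Lemma peano_kernel_integral : integral_on a b S =
  (b - a) ^+ (n + 1) / (n`!%:R * 2 ^+ n) * ((n + 1)%:R^-1 - theta).
Proof.
have -> : integral_on a b S = integral_on a b (fun x => S x * 1).
  by apply: eq_Rintegral => x _; rewrite mulr1.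
rewrite peano_kernel_integralM//; last first.
  have := peano_kernel_integrable; apply: eq_integrable => // x _ /=.
  by rewrite mulr1.
under eq_Rintegral do rewrite mulr1.
under [in X in _ + X]eq_Rintegral do rewrite mulr1.
have n0 : (0 < n)%N by lia.
rewrite !Rintegral_kernel_poly ?mid_ge ?mid_le//.
rewrite !horner_kernel_poly !subrr mid_subl mid_subr !expr0n /= !mul0r.
rewrite (gtn_eqF n0) !mul0r !mulr0 !subr0 !sub0r.
have hn : (- h) ^+ n = h ^+ n :> R.
  by rewrite exprNn -signr_odd mul2n odd_double mul1r.
rewrite !exprS hn addn1 exprS expr_div_n factS natrM.
have F0 : n`!%:R != 0 :> R by rewrite pnatr_eq0 -lt0n fact_gt0.
have E0 : 2 ^+ n != 0 :> R by rewrite expf_neq0.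
have N0 : n.+1%:R != 0 :> R by rewrite pnatr_eq0.
move: (n`!%:R) (2 ^+ n) (n.+1%:R) ((b - a) ^+ n) F0 E0 N0 => F E N L F0 E0 N0.
by field; rewrite F0 E0 N0.
Qed.

Lemma peano_kernel_sqr_integral : integral_on a b (fun x => S x * S x) =
  (n`!%:R * 2 ^+ n) ^- 2 * (b - a) ^+ (2 * n + 1) *
  ((4 * m%:R + 1)^-1 - theta + theta ^+ 2 * (2 * m%:R) ^+ 2 / (4 * m%:R - 1)).
Proof.
rewrite peano_kernel_integralM//; last exact: peano_kernel_sqr_integrable.
have -> : \int[mu]_(x in `[a, mid]) ((left_kernel a b m theta).[x] * S x) =
    \int[mu]_(x in `[a, mid])
      ((left_kernel a b m theta).[x] * (left_kernel a b m theta).[x]).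
  apply: eq_Rintegral => x; rewrite inE/= in_itv/= => /andP[_ xm].
  by rewrite peano_kernel_left.
have -> : \int[mu]_(x in `[mid, b]) ((right_kernel a b m theta).[x] * S x) =
    \int[mu]_(x in `[mid, b])
      ((right_kernel a b m theta).[x] * (right_kernel a b m theta).[x]).
  apply: eq_Rintegral => x; rewrite inE/= in_itv/= => /andP[mx _].
  by rewrite peano_kernel_right.
have [k nE] : exists k, n = k.+1 by exists n.-1; lia.
rewrite /left_kernel /right_kernel nE.
rewrite !Rintegral_kernel_poly_sqr ?mid_ge ?mid_le// /kernel_sqr_primitive.
rewrite !(hornerD, hornerN, hornerZ, horner_exp, hornerX, hornerC).
rewrite !subrr mid_subl mid_subr !expr0n.
have hk (x : R) : x ^+ (2 * k) = x ^+ k * x ^+ k by rewrite mul2n -addnn exprD.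
have hn : (- h) ^+ k * (- h) ^+ k = h ^+ k * h ^+ k by rewrite -!hk !exprM sqrrN.
rewrite !addn3 !addn2 !addn1 /= !mulr0.
rewrite (_ : (2 * k.+1).+1 = (2 * k).+3); last by lia.
rewrite ![_ ^+ _.+3]exprS ![_ ^+ _.+2]exprS ![_ ^+ (2 * k).+1]exprS !hk hn.
rewrite [2 ^+ k.+1]exprS.
rewrite !expr_div_n.
have M : m%:R = (k.+1)%:R / 2 :> R by rewrite -nE natrM mulrC mulKf.
have e1 : (2 * k).+1%:R = 2 * k%:R + 1 :> R by rewrite -natr1 natrM.
have e3 : (2 * k).+3%:R = 2 * k%:R + 3 :> R.
  by rewrite -addn3 natrD natrM.
have k1 : k.+1%:R = k%:R + 1 :> R by rewrite natr1.
rewrite M factS natrM e1 e3 k1.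
have k0 : k`!%:R != 0 :> R by rewrite pnatr_eq0 -lt0n fact_gt0.
have E0 : 2 ^+ k != 0 :> R by rewrite expf_neq0.
have kge : 0 <= k%:R :> R by rewrite ler0n.
move: (k`!%:R) (k%:R) (2 ^+ k) ((b - a) ^+ k) k0 kge E0 => F K E L F0 K0 E0.
field.
rewrite F0 E0 !lt0r_neq0//; lra.
Qed.

Lemma peano_kernel_covariance :
  covariance_on a b S S = (sharp_constant m theta * (b - a) `^ (2 * m%:R + 2^-1)) ^+ 2.
Proof.
have c0 := covariance_ge0 ab peano_kernel_integrable peano_kernel_sqr_integrable.
have L0 : 0 < b - a by rewrite subr_gt0.
set X := ((theta ^+ 2 * (2 * m%:R) ^+ 2 * (4 * m%:R + 1)
       - theta * (16 * m%:R ^+ 2 - 1) + (4 * m%:R - 1))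
      - (16 * m%:R ^+ 2 - 1) * ((2 * m%:R + 1)^-1 - theta) ^+ 2) /
     ((4 * m%:R + 1) * (4 * m%:R - 1)).
have cE : covariance_on a b S S = (n`!%:R * 2 ^+ n) ^- 2 * (b - a) ^+ (2 * n + 1) * X.
  rewrite /covariance_on peano_kernel_sqr_integral peano_kernel_integral /X.
  rewrite !addn1 (_ : 2 * n = n + n)%N; last by lia.
  rewrite ![(b - a) ^+ _.+1]exprS exprD.
  have -> : n.+1%:R = 2 * m%:R + 1 :> R by rewrite -natr1 natrM.
  have F0 : n`!%:R != 0 :> R by rewrite pnatr_eq0 -lt0n fact_gt0.
  have E0 : 2 ^+ n != 0 :> R by rewrite expf_neq0.
  have M1 : 1 <= m%:R :> R by rewrite ler1n.
  have ba0 : b - a != 0 by rewrite gt_eqF.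
  move: (n`!%:R) (2 ^+ n) (m%:R) ((b - a) ^+ n) (b - a) F0 E0 M1 ba0 => F E M P L F0 E0 M1 ba0.
  field.
  by rewrite F0 E0 ba0 !lt0r_neq0//; lra.
(* The radicand is nonnegative because it is a variance up to a positive factor; this makes squaring
   the square root legitimate. *)
have X0 : 0 <= X.
  have p0 : 0 < (n`!%:R * 2 ^+ n) ^- 2 * (b - a) ^+ (2 * n + 1).
    by rewrite mulr_gt0 ?exprn_gt0// invr_gt0 exprn_gt0// mulr_gt0 ?exprn_gt0//
      ltr0n fact_gt0.
  by move: c0; rewrite cE pmulr_rge0.
rewrite cE /sharp_constant -/X [RHS]exprMn [X in _ = X * _]exprMn sqr_sqrtr// exprVn.
rewrite [RHS]mulrAC; congr (_ * _ * _).
(* Twice the real exponent [2m + 1/2] is the natural number [2n + 1]. *)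
rewrite -[RHS]powR_mulrn ?powR_ge0// -powRrM -powR_mulrn ?(ltW L0)//; congr (_ `^ _).
by rewrite natrD !natrM; field.
Qed.

End peano_kernel_variance.

(** * Extremal functions *)

Section iterated_antiderivative.
Context {R : realType}.
Variables (a b : R).
Hypothesis ab : a < b.
Local Notation mu := (@lebesgue_measure R).

(** Integrating from [c'], strictly right of [c], keeps [g] continuous on the whole closed segment
    [[c', x + 1]]. *)
Lemma antiderivative_right_of (g : R -> R) (c c' : R) : c < c' ->
  (forall x, c < x -> {for x, continuous g}) ->
  exists G : R -> R, forall x : R, c' < x -> is_derive x 1 G (g x).
Proof.
move=> cc' cg; exists (fun x => \int[mu]_(t in `[c', x]) g t) => x c'x.
have intg : mu.-integrable `[c', x + 1] (EFin \o g).
  apply: continuous_compact_integrable; first exact: segment_compact.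
  apply: continuous_in_subspaceT => y; rewrite inE/= in_itv/= => /andP[cy _].
  exact/cg/(lt_le_trans cc').
have x1 : x < x + 1 by rewrite ltrDl.
have [dG GE] := continuous_FTC1_closed x1 intg c'x (cg x (lt_trans cc' c'x)).
by apply: DeriveDef; [exact: dG|rewrite -derive1E GE].
Qed.

(** Each integration moves [c] halfway towards [a] without reaching it, so that all derivatives are
    two-sided even at [a]. *)
Lemma iterated_antiderivative (n : nat) (g : R -> R) (c : R) : c < a ->
  (forall x, c < x -> {for x, continuous g}) ->
  exists F : nat -> R -> R, F n = g /\
    forall k x, (k < n)%N -> a <= x -> is_derive x 1 (F k) (F k.+1 x).
Proof.
elim: n g c => [|n IH] g c ca cg; first by exists (fun=> g).
have [cc' c'a] : c < (c + a) / 2 /\ (c + a) / 2 < a by split; lra.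
have [G dG] := antiderivative_right_of cc' cg.
have cG x : (c + a) / 2 < x -> {for x, continuous G}.
  by move=> /dG /@ex_derive /derivable1_diffP/differentiable_continuous.
have [F [Fn dF]] := IH G _ c'a cG.
exists (fun k => if (k <= n)%N then F k else g); rewrite ltnn; split=> // k x.
rewrite ltnS => kn ax; rewrite kn; have [kn'|nk] := ltnP k n; first exact: dF.
have -> : k = n by apply/eqP; rewrite eqn_leq kn nk.
by rewrite Fn; apply: dG; exact: lt_le_trans ax.
Qed.

(** Only values on [[a, b]] enter [derive_on]. This matters in the induction that follows, where
    [deriven_on] agrees with the chain of antiderivatives on [[a, b]] only. *)
Lemma eq_in_derive_on (g G : R -> R) (x l : R) : x \in `[a, b] ->
  {in `[a, b], g =1 G} -> is_derive x 1 G l ->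
  derivable_on a b g x /\ derive_on a b g x = l.
Proof.
move=> xab gG /(is_derive_quotient_cvg a b) cG.
suff cg : (g y - g x) / (y - x) @[y --> within `[a, b] x^'] --> l.
  by split; [apply/cvg_ex; exists l|exact: cvg_derive_on].
apply: cvg_trans cG; apply: near_eq_cvg.
by rewrite near_withinE; apply: nearW => y yab; rewrite !gG.
Qed.

Lemma deriven_on_chain (n : nat) (F : nat -> R -> R) :
  (forall k x, (k < n)%N -> a <= x -> is_derive x 1 (F k) (F k.+1 x)) ->
  forall k, (k <= n)%N -> {in `[a, b], deriven_on a b k (F 0%N) =1 F k}.
Proof.
move=> dF; elim=> [//|k IH kn] x xab.
have ax : a <= x by move: xab; rewrite in_itv/= => /andP[].
by have [] := eq_in_derive_on xab (IH (ltnW kn)) (dF k x kn ax).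
Qed.

Lemma continuous_L2_on (g : R -> R) : {within `[a, b], continuous g} -> L2_on a b g.
Proof.
move=> cg; have mAB : measurable (`[a, b]%classic : set (measurableTypeR R)).
  exact: measurable_itv.
have mg : measurable_fun (`[a, b]%classic : set (measurableTypeR R)) g.
  by apply: subspace_continuous_measurable_fun.
have igg : mu.-integrable `[a, b] (EFin \o (fun x => g x * g x)).
  apply: (continuous_segment_integrable (lexx a) (lexx b)).
  by move=> x; apply: (@continuousM _ (subspace `[a, b])); exact: cg.
rewrite /L2_on inE; apply/andP; split; first by rewrite inE/=; apply/(measurable_restrictT _ mAB).
rewrite inE /finite_norm unlock /Lnorm; apply: poweR_lty.
have -> : (\int[mu]_x `|(EFin \o (g \_ `[a, b])) x| `^ 2 =
    \int[mu]_(x in `[a, b]) (g x * g x)%:E)%E.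
  rewrite [RHS]integral_mkcond; apply: eq_integral => x _ /=.
  rewrite powR_mulrn// real_normK ?num_real// patchE [in RHS]patchE.
  by case: ifPn => _; rewrite expr2// mulr0.
apply: le_lt_trans (integrable_lty mAB igg) => //.
Qed.

(** Applied to the Peano kernel, this supplies the extremal function. The derivative of order [n.-1]
    is absolutely continuous since its own derivative [g] is bounded on [[a, b]]. *)
Lemma iterated_antiderivative_admissible (n : nat) (g : R -> R) : (0 < n)%N ->
  continuous g ->
  exists2 f : R -> R, admissible a b n f & {in `[a, b], deriven_on a b n f =1 g}.
Proof.
move=> n0 cg; have a1 : a - 1 < a by rewrite ltrBlDr ltrDl.
have [F [Fn dF]] := iterated_antiderivative n a1 (fun x _ => cg x).
have FE := deriven_on_chain dF.
have dd k x : (k < n)%N -> x \in `[a, b] ->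
    derivable_on a b (deriven_on a b k (F 0%N)) x.
  move=> kn xab; have ax : a <= x by move: xab; rewrite in_itv/= => /andP[].
  by have [] := eq_in_derive_on xab (FE k (ltnW kn)) (dF k x kn ax).
have gE : {in `[a, b], deriven_on a b n (F 0%N) =1 g}.
  by move=> x xab; rewrite FE// Fn.
have cgw : {within `[a, b], continuous g} by exact: continuous_subspaceT.
exists (F 0%N) => //; split.
- by move=> k kn x xab; apply: dd => //; lia.
- have [M M0 bM] := continuous_segment_bounded ab cgw.
  have n1 : (n.-1 < n)%N by lia.
  apply: (@derivable_on_abs_continuous _ a b ab _ M) => x xab; first exact: dd.
  rewrite -[derive_on a b _]/(deriven_on a b n.-1.+1 (F 0%N)) prednK// gE//.
  exact: bM.
- have := continuous_L2_on cgw; rewrite /L2_on.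
  suff -> : g \_ `[a, b] = deriven_on a b n (F 0%N) \_ `[a, b] by [].
  apply/funext => x; rewrite !patchE; case: ifPn => // xab; rewrite gE//.
  by move: xab; rewrite inE.
Qed.

End iterated_antiderivative.

(** * The error as a covariance, and the sharp bound *)

Section error_term.
Context {R : realType}.
Variables (a b : R) (m : nat) (theta : R).
Hypotheses (ab : a < b) (m0 : (0 < m)%N).
Local Notation mu := (@lebesgue_measure R).
Local Notation n := (2 * m)%N.
Local Notation S := (peano_kernel a b m theta).

Lemma integrable_mul_sqr (f g : R -> R) :
  measurable_fun (`[a, b]%classic : set (measurableTypeR R)) f ->
  measurable_fun (`[a, b]%classic : set (measurableTypeR R)) g ->
  mu.-integrable `[a, b] (EFin \o (fun x => f x * f x)) ->
  mu.-integrable `[a, b] (EFin \o (fun x => g x * g x)) ->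
  mu.-integrable `[a, b] (EFin \o (fun x => f x * g x)).
Proof.
move=> mf mg intf intg; have [i _] := segment_integral_lin 1 intf intg.
apply: le_integrable i; first exact: measurable_itv.
  by apply/measurable_EFinP; exact: measurable_funM.
move=> x _ /=; rewrite lee_fin mul1r -!expr2 normrM [leRHS]ger0_norm; last first.
  by rewrite addr_ge0// sqr_ge0.
rewrite -(real_normK (num_real (f x))) -(real_normK (num_real (g x))).
have := sqr_ge0 (`|f x| - `|g x|); rewrite sqrrB.
have := mulr_ge0 (normr_ge0 (f x)) (normr_ge0 (g x)).
by rewrite -mulr_natl; lra.
Qed.

Variable f : R -> R.
Hypothesis admf : admissible a b n f.
Local Notation D := (deriven_on a b n f).

Lemma peano_kernel_mul_integrable : mu.-integrable `[a, b] (EFin \o (fun x => S x * D x)).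
Proof.
have [_ _ L2D] := admf; apply: integrable_mul_sqr.
- apply: measurable_funTS; apply: continuous_measurable_fun.
  exact: peano_kernel_continuous.
- exact: L2_on_measurable.
- exact: peano_kernel_sqr_integrable.
- exact: L2_on_integrable_sqr.
Qed.

(** The integral of [S f^(n)] is [I - F_n], and the product of the integrals of [S] and [f^(n)]
    divided by [b - a] is the correction term. *)
Lemma error_boundE (C : R) : error_bound a b m theta C f <->
  `|covariance_on a b S D| <=
  C * (b - a) `^ (2 * m%:R + 2^-1) * Num.sqrt (covariance_on a b D D).
Proof.
have [_ _ L2D] := admf; have n0 : (0 < n)%N by lia.
rewrite /error_bound sigma_on_covariance// /covariance_on.
rewrite (peano_kernel_identity ab m0 admf peano_kernel_mul_integrable).
rewrite peano_kernel_integral// [integral_on a b D](admissible_FTC ab admf n0) subn1.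
set p := _ / _ * (_ - theta).
rewrite [(b - a)^-1 * p]mulrC -[p * _ * _]mulrA [(b - a)^-1 * (_ - _)]mulrC.
exact: iff_refl.
Qed.

End error_term.

Theorem theorem9 (R : realType) (a b : R) (m : nat) (theta : R)
    (hab : a < b) (hm : (1 < 2 * m)%N) (htheta : 0 <= theta <= 1) :
  (forall f : R -> R, admissible a b (2 * m) f ->
     error_bound a b m theta (sharp_constant m theta) f) /\
  (forall C : R, 0 < C ->
     (forall f : R -> R, admissible a b (2 * m) f ->
        error_bound a b m theta C f) ->
     sharp_constant m theta <= C).
Proof.
have m0 : (0 < m)%N by lia.
pose K := peano_kernel a b m theta.
pose P := (b - a) `^ (2 * m%:R + 2^-1).
have P0 : 0 < P by rewrite powR_gt0 ?subr_gt0.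
have c0 : 0 <= sharp_constant m theta.
  by rewrite mulr_ge0 ?sqrtr_ge0// invr_ge0 mulr_ge0// exprn_ge0.
have covKK : covariance_on a b K K = (sharp_constant m theta * P) ^+ 2.
  exact: peano_kernel_covariance.
have cP0 : 0 <= sharp_constant m theta * P by rewrite mulr_ge0// ltW.
split=> [f admf|C C0 bound].
  apply/(error_boundE _ hab m0 admf); rewrite -/P -/K.
  have [_ _ L2D] := admf.
  have intDD := L2_on_integrable_sqr L2D.
  have intKK : lebesgue_measure.-integrable `[a, b] (EFin \o (fun x => K x * K x)).
    exact: peano_kernel_sqr_integrable.
  have CS := covariance_Cauchy_Schwarz hab (peano_kernel_integrable a b m theta)
    (integrable_sqr_integrable (L2_on_measurable L2D) intDD) intKK intDD
    (peano_kernel_mul_integrable theta admf).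
  rewrite -sqrtr_sqr; apply: (le_trans (ler_wsqrtr CS)).
  by rewrite -/K covKK sqrtrM ?sqr_ge0// sqrtr_sqr ger0_norm.
(* For this [f] the derivative [f^(n)] is the kernel [K] itself, so every covariance below equals
   that of [K] with itself. *)
have [f admf fK] := iterated_antiderivative_admissible hab (ltnW hm)
  (@peano_kernel_continuous _ a b m theta).
have KD : integral_on a b (deriven_on a b (2 * m) f) = integral_on a b K.
  by apply: eq_Rintegral => x; rewrite inE => /fK.
have KD2 : integral_on a b (fun x => K x * deriven_on a b (2 * m) f x) =
    integral_on a b (fun x => K x * K x).
  by apply: eq_Rintegral => x; rewrite inE => /fK ->.
have KD3 : integral_on a b (fun x => deriven_on a b (2 * m) f x * deriven_on a b (2 * m) f x) =
    integral_on a b (fun x => K x * K x).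
  by apply: eq_Rintegral => x; rewrite inE => /fK ->.
have /(error_boundE _ hab m0 admf) := bound f admf.
rewrite /covariance_on -/K KD KD2 KD3 -/P -/(covariance_on a b K K) covKK sqrtr_sqr.
rewrite ger0_norm ?sqr_ge0// ger0_norm// expr2.
(* With [c] the sharp constant, the bound reads [(c P)^2 <= C P (c P)]. If [c = 0] the claim follows
   from [C > 0]; otherwise [c P] and then [P] cancel. *)
move: c0; rewrite le_eqVlt => /predU1P[<- _|c0]; first exact: ltW.
by rewrite (ler_pM2r (mulr_gt0 c0 P0)) ler_pM2r.
Qed.
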